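(* Let $X$ be an irreducible nondegenerate curve in $\mathbb{P}^N$ over an algebraically closed field of characteristic zero. Let $g$ be the generic rank and $m$ the maximal rank with respect to $X$. Then $m \leq 2g-1$. Moreover, if in addition the secant variety $\sigma_{g-1}(X)$ is a hypersurface, then $m \le 2g-2$.
   Context: The rank of a point $p\in\mathbb{P}^N$ with respect to $X$ is the least $r$ such that $p$ lies in the linear span of some $r$ distinct points of $X$. The generic rank $g$ is the rank attained on a dense open subset of $\mathbb{P}^N$; $m$ is the maximum value of the rank. $\sigma_{k}(X)$ is the Zariski closure of the set of points of rank at most $k$. *)

(* Defs.v *)
From HB Require Import structures.
From mathcomp Require Import all_boot all_order all_algebra.
From mathcomp Require Import mpoly.
Set Implicit Arguments. Unset Strict Implicit. Unset Printing Implicit Defensive.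
Import GRing.Theory.
Local Open Scope ring_scope.

(* Points of P^N are represented by nonzero vectors of k^(N+1);
   subsets of P^N by predicates on vectors (only nonzero vectors are members). *)
Definition vec (k : fieldType) (N : nat) := 'I_N.+1 -> k.
Definition pset (k : fieldType) (N : nat) := vec k N -> Prop.

Definition nonzero (k : fieldType) N (v : vec k N) : Prop := exists j, v j != 0.

Definition proj_eq (k : fieldType) N (u v : vec k N) : Prop :=
  exists a : k, a != 0 /\ forall j, u j = a * v j.

Definition homogeneous (k : fieldType) N (p : {mpoly k[N.+1]}) : Prop :=
  exists d : nat, p \is d.-homog.

Definition zero_set (k : fieldType) N (S : {mpoly k[N.+1]} -> Prop) : pset k N :=
  fun v => nonzero v /\ forall p, S p -> p.@[v] = 0.

Definition zclosed (k : fieldType) N (Z : pset k N) : Prop :=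
  exists S : {mpoly k[N.+1]} -> Prop,
    (forall p, S p -> homogeneous p) /\ forall v, Z v <-> zero_set S v.

Definition zopen (k : fieldType) N (U : pset k N) : Prop :=
  zclosed (fun v => nonzero v /\ ~ U v) /\ forall v, U v -> nonzero v.

Definition subsetP (k : fieldType) N (A B : pset k N) : Prop := forall v, A v -> B v.

Definition zclosure (k : fieldType) N (A : pset k N) : pset k N :=
  fun v => nonzero v /\ forall Z, zclosed Z -> subsetP A Z -> Z v.

Definition zdense (k : fieldType) N (A : pset k N) : Prop :=
  forall v, nonzero v -> zclosure A v.

Definition irreducible_closed (k : fieldType) N (X : pset k N) : Prop :=
  zclosed X /\ (exists v, X v) /\
  forall Z1 Z2 : pset k N, zclosed Z1 -> zclosed Z2 ->
    (forall v, X v -> Z1 v \/ Z2 v) -> subsetP X Z1 \/ subsetP X Z2.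

Definition has_chain (k : fieldType) N (X : pset k N) (n : nat) : Prop :=
  exists Z : nat -> pset k N,
    (forall i, (i <= n)%N -> irreducible_closed (Z i)) /\
    (forall i, (i < n)%N -> subsetP (Z i) (Z i.+1) /\ ~ subsetP (Z i.+1) (Z i)) /\
    subsetP (Z n) X.

Definition zdim (k : fieldType) N (X : pset k N) (d : nat) : Prop :=
  has_chain X d /\ ~ has_chain X d.+1.

Definition irreducible_curve (k : fieldType) N (X : pset k N) : Prop :=
  irreducible_closed X /\ zdim X 1.

Definition proj_nondegenerate (k : fieldType) N (X : pset k N) : Prop :=
  forall c : vec k N, (forall x, X x -> \sum_(j < N.+1) c j * x j = 0) ->
    forall j, c j = 0.

Definition hypersurface (k : fieldType) N (Z : pset k N) : Prop :=
  exists (f : {mpoly k[N.+1]}) (d : nat), (0 < d)%N /\ f != 0 /\ f \is d.-homog /\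
    forall v, Z v <-> zero_set (fun p => p = f) v.

Definition rank_le (k : fieldType) N (X : pset k N) (p : vec k N) (r : nat) : Prop :=
  exists (x : 'I_r -> vec k N) (c : 'I_r -> k),
    (forall i, X (x i)) /\
    (forall i j, i != j -> ~ proj_eq (x i) (x j)) /\
    (forall l, p l = \sum_(i < r) c i * x i l).

Definition has_rank (k : fieldType) N (X : pset k N) (p : vec k N) (r : nat) : Prop :=
  rank_le X p r /\ forall r', (r' < r)%N -> ~ rank_le X p r'.

Definition generic_rank (k : fieldType) N (X : pset k N) (g : nat) : Prop :=
  exists U : pset k N, zopen U /\ zdense U /\ forall p, U p -> has_rank X p g.

Definition max_rank (k : fieldType) N (X : pset k N) (m : nat) : Prop :=
  (exists p, nonzero p /\ has_rank X p m) /\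
  forall p r, nonzero p -> has_rank X p r -> (r <= m)%N.

Definition secant (k : fieldType) N (X : pset k N) (s : nat) : pset k N :=
  zclosure (fun p => nonzero p /\ exists r, (r <= s)%N /\ has_rank X p r).

(* Main.v *)
Require Import Defs.
From Stdlib Require Import Classical ClassicalEpsilon.
From HB Require Import structures.
From mathcomp Require Import all_boot all_order all_algebra all_field.
From mathcomp Require Import generic_quotient ring_quotient.
From mathcomp Require Import mpoly zify.

(* The maximal rank is at most N, while N < 2g because sums of at most g points
   of a curve fill out a set of dimension at most 2g (and N <= 2(g-1) if the
   points of rank at most g-1 are dense in a hypersurface); both assertions
   follow. The dimension bound is a count of monomials: restricted to the cone
   over X, the forms of degree D span a space of dimension O(D).

   For the bound by N, let p be a point outside X and let a, b be linear forms
   vanishing at p without common zero on X. It suffices that for some s the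
   points of X on the hyperplane a + s b = 0 span it. Over the function field,
   with t = - a/b transcendental, a linear relation between the coordinates with
   coefficients in k[t] is (T - t) q(T) at T = t; the coefficients of q stabilize
   a finite-dimensional space of forms because the coordinate ring is integral
   over k[a,b], so they are constants, and the relation is a multiple of a + T b.
   Hence the coordinates span a space of dimension N over k(t). By the
   primitive element theorem (characteristic 0) the generic fibre is given by a
   separable polynomial over k(t), and specializing t yields the points. *)

Set Implicit Arguments. Unset Strict Implicit. Unset Printing Implicit Defensive.
Import Order.Theory GRing.Theory.
Local Open Scope ring_scope.

(** * Substitutions in multivariate polynomials *)

(** The points of the section by a + s b = 0 are known only through equations. Hence everything
    about the generic fibre is brought to identities over [k[T]], which survive T = s for all but
    finitely many s: pseudo-division instead of division, a right inverse up to a denominator, a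
    Bezout relation as the witness of separability. The parameter is - a/b because the generic point
    then lies on a + T b = 0. This relation is unavoidable, but it involves every coordinate whose
    coefficient in b is nonzero; leaving out one such coordinate leaves N independent ones, and the
    left-out one is recovered from the equation of the hyperplane. Scaling is handled by working on
    the cone: for the count each point of X contributes two parameters, position and scale, and for
    the generic point the scale is fixed by b = 1, so that forms of all degrees become elements of
    one field, filtered by degree. *)

Lemma mpoly_rmorph_eq (R : comNzRingType) (S : comNzRingType) n
    (f g : {rmorphism {mpoly R[n]} -> S}) :
  (forall c, f c%:MP = g c%:MP) -> (forall i, f 'X_i = g 'X_i) -> f =1 g.
Proof.
move=> fgC fgX p; rewrite (mpolyE p) !rmorph_sum; apply: eq_bigr => m _ /=.
rewrite -mul_mpolyC !rmorphM fgC mpolyXE_id !rmorph_prod; congr (_ * _).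
by apply: eq_bigr => i _; rewrite !rmorphXn fgX.
Qed.

(* [unfold l] substitutes 'X_(j+1) + l_j 'X_0 for 'X_(j+1) and views the result
   as a polynomial in 'X_0; [refold] is its inverse. *)
Section Unfold.
Variables (k : comNzRingType) (n : nat) (l : 'I_n -> k).

Definition unfold_var (i : 'I_n.+1) : {poly {mpoly k[n]}} :=
  if unlift ord0 i is Some j then ('X_j)%:P + (l j)%:MP%:P * 'X else 'X.

Definition unfold : {mpoly k[n.+1]} -> {poly {mpoly k[n]}} :=
  mmap (polyC \o @mpolyC n k) unfold_var.
HB.instance Definition _ := GRing.RMorphism.on unfold.

Lemma unfoldC c : unfold c%:MP = c%:MP%:P.
Proof. exact: (mmapC _ (polyC \o @mpolyC n k)). Qed.

Lemma unfoldX i : unfold 'X_i = unfold_var i.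
Proof. by rewrite /unfold (mmapX _ (polyC \o @mpolyC n k)) mmap1U. Qed.

Definition fold_coef : {mpoly k[n]} -> {mpoly k[n.+1]} :=
  mmap (@mpolyC n.+1 k) (fun j => 'X_(lift ord0 j) - (l j)%:MP * 'X_ord0).
HB.instance Definition _ := GRing.RMorphism.on fold_coef.

Lemma fold_coefC c : fold_coef c%:MP = c%:MP.
Proof. exact: (mmapC _ (@mpolyC n.+1 k)). Qed.

Lemma fold_coefX j : fold_coef 'X_j = 'X_(lift ord0 j) - (l j)%:MP * 'X_ord0.
Proof. by rewrite /fold_coef (mmapX _ (@mpolyC n.+1 k)) mmap1U. Qed.

Definition refold : {poly {mpoly k[n]}} -> {mpoly k[n.+1]} :=
  horner_eval 'X_ord0 \o map_poly fold_coef.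
HB.instance Definition _ := GRing.RMorphism.on refold.

Lemma refoldC p : refold p%:P = fold_coef p.
Proof. by rewrite /refold /= map_polyC /horner_eval hornerC. Qed.

Lemma refoldX : refold 'X = 'X_ord0.
Proof. by rewrite /refold /= map_polyX /horner_eval hornerX. Qed.

Lemma unfoldK : cancel unfold refold.
Proof.
move=> p; apply: (mpoly_rmorph_eq (f := refold \o unfold) (g := idfun)) => [c|i].
  by rewrite /= unfoldC refoldC fold_coefC.
rewrite /= unfoldX /unfold_var; case: unliftP => [j ->|->]; last exact: refoldX.
by rewrite rmorphD rmorphM /= !refoldC refoldX fold_coefC fold_coefX subrK.
Qed.

Lemma unfold_eval (v : 'I_n -> k) (w : k) (p : {mpoly k[n.+1]}) :
  (map_poly (meval v) (unfold p)).[w] =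
  p.@[fun i => if unlift ord0 i is Some j then v j + l j * w else w].
Proof.
set u := (X in p.@[X]).
apply: (mpoly_rmorph_eq (f := horner_eval w \o map_poly (meval v) \o unfold)
   (g := meval u)) => [c|i].
  by rewrite /= unfoldC map_polyC /horner_eval hornerC /= !mevalC.
rewrite /= unfoldX mevalXU /u /unfold_var /horner_eval.
case: unliftP => [j _|_]; last by rewrite map_polyX hornerX.
rewrite rmorphD rmorphM /= !map_polyC map_polyX hornerD hornerM !hornerC hornerX.
by rewrite /= mevalXU mevalC.
Qed.

End Unfold.

(** Induction on the number of variables: keep the leading coefficient in one variable nonzero, then
    avoid the finitely many roots of the resulting polynomial; an algebraically closed field is
    infinite. *)
Lemma mpoly_nonvanish (k : closedFieldType) n (f : {mpoly k[n]}) :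
  f != 0 -> exists v, f.@[v] != 0.
Proof.
elim: n f => [|n IH] f nz_f.
  exists (fun=> 0); apply: contra nz_f => /eqP f0.
  have: (msize f <= 1)%N.
    rewrite msizeE; apply/bigmax_leqP_seq => m _ _; rewrite ltnS.
    by rewrite /mdeg big_tuple big_ord0.
  by move/msize1_polyC => fC; rewrite fC mevalC in f0; rewrite fC f0 mpolyC0.
have nzU : unfold (fun=> 0) f != 0.
  by apply: contra nz_f => /eqP U0; rewrite -(unfoldK (fun=> 0) f) U0 rmorph0.
have [v hv] := IH _ (etrans (congr1 negb (lead_coef_eq0 _)) nzU).
have /closed_nonrootP[w hw] : map_poly (meval v) (unfold (fun=> 0) f) != 0.
  apply: contra hv => /eqP/(congr1 (fun q : {poly k} => q`_(size (unfold (fun=> 0) f)).-1)).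
  by rewrite coef_map coef0 => ->.
by move: hw; rewrite rootE unfold_eval => hw; eexists; exact: hw.
Qed.

(* [q] has degree at most [d], and [c] (possibly zero) is its coefficient there. *)
Definition has_top (S : nzRingType) (d : nat) (q : {poly S}) (c : S) : Prop :=
  (size q <= d.+1)%N /\ q`_d = c.

Lemma has_topM (S : nzRingType) d e (p q : {poly S}) a b :
  has_top d p a -> has_top e q b -> has_top (d + e) (p * q) (a * b).
Proof.
move=> [sp <-] [sq <-]; split.
  apply: leq_trans (size_polyMleq _ _) _.
  by have := leq_add sp sq; rewrite addSn addnS; case: (_ + _)%N.
have dlt : (d < (d + e).+1)%N by rewrite ltnS leq_addr.
rewrite coefM (bigD1 (Ordinal dlt)) //= addKn big1 ?addr0 // => i /eqP ne_id.
have [lt_id|le_di] := ltnP i d.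
  by rewrite [q`__]nth_default ?mulr0 // (leq_trans sq) // ltn_subRL ltn_add2r.
rewrite nth_default ?mul0r // (leq_trans sp) // ltn_neqAle le_di andbT.
by apply/eqP => di; apply: ne_id; apply: val_inj.
Qed.

Lemma has_top1 (S : nzRingType) : has_top 0 (1 : {poly S}) 1.
Proof. by split; rewrite ?size_poly1 // coef1. Qed.

Lemma mmap1_top (S : comNzRingType) n (h : 'I_n -> {poly S}) (m : 'X_{1..n}) :
  (forall i, (size (h i) <= 2)%N) ->
  has_top (mdeg m) (mmap1 h m) (mmap1 (fun i => (h i)`_1) m).
Proof.
move=> sh; rewrite mdegE /mmap1.
elim/big_rec3: _ => [|i c q d _ IH]; first exact: has_top1.
apply: has_topM IH; elim: (m i) => [|e IHe]; first by rewrite !expr0; exact: has_top1.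
by rewrite !exprS -add1n; apply: has_topM IHe; split.
Qed.

(** When polynomials of degree at most 1 are substituted, only the component of degree [d] reaches
    degree [d], and there only the linear coefficients contribute. *)
Lemma mmap_top (k S : comNzRingType) (iota : {rmorphism k -> S}) n
    (h : 'I_n -> {poly S}) d (p : {mpoly k[n]}) :
  (forall i, (size (h i) <= 2)%N) -> (msize p <= d.+1)%N ->
  has_top d (mmap (polyC \o iota) h p)
    (mmap iota (fun i => (h i)`_1) (pihomog mdeg d p)).
Proof.
move=> sh sp; rewrite (mmapE d.+1 sp) (pihomogwE _ _ sp) raddf_sum /=; split.
  apply: (leq_trans (size_sum _ _ _)); apply/bigmax_leqP => m _.
  apply: leq_trans (size_polyMleq _ _) _.
  have [smh _] := mmap1_top m sh.
  have := leq_add (size_polyC_leq1 (iota p@_m)) (leq_trans smh (bmdeg m)).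
  by rewrite add1n; case: (_ + _)%N.
rewrite coef_sum [RHS]big_mkcond; apply: eq_bigr => m _ /=.
have [smh tmh] := mmap1_top m sh; rewrite coefCM.
case: eqP => [md|/eqP ne_md]; first by rewrite mmapZ mmapX -tmh md.
rewrite nth_default ?mulr0 // (leq_trans smh) // ltn_neqAle ne_md.
by rewrite -ltnS bmdeg.
Qed.

(** * Nullstellensatz *)

Lemma mmap_dhomog (k S : comNzRingType) (phi : {rmorphism k -> S}) n d
    (p : {mpoly k[n]}) (c : S) (v : 'I_n -> S) :
  p \is d.-homog -> mmap phi (fun i => c * v i) p = c ^+ d * mmap phi v p.
Proof.
move/dhomogP => hp; rewrite /mmap mulr_sumr big_seq [RHS]big_seq.
apply: eq_bigr => m /hp /= dE; rewrite mulrCA; congr (_ * _).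
have {dE}<- : mdeg m = d by [].
rewrite mdegE -prodrXr -big_split /=; apply: eq_bigr => i _.
by rewrite exprMn.
Qed.

Lemma meval_dhomog (k : comNzRingType) n d (p : {mpoly k[n]}) c v :
  p \is d.-homog -> p.@[fun i => c * v i] = c ^+ d * p.@[v].
Proof. exact: (mmap_dhomog idfun). Qed.

Definition ideal_closed (R : comNzRingType) (J : R -> Prop) : Prop :=
  [/\ J 0, forall f g, J f -> J g -> J (f + g) & forall f g, J g -> J (f * g)].

(** A nonzero element of least degree generates the ideal and, not being a unit, has a root. The
    induction reaches it by passing from [q] to a nonzero remainder. *)
Lemma poly_ideal_root (k : closedFieldType) (K : {poly k} -> Prop) :
  ideal_closed K -> ~ K 1 -> exists w, forall q, K q -> q.[w] = 0.
Proof.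
move=> [K0 KD KM] K1.
have step s : forall q : {poly k}, (size q <= s)%N -> q != 0 -> K q ->
    exists w, forall q', K q' -> q'.[w] = 0.
  elim: s => [|s IH] q; first by rewrite size_poly_leq0 => /eqP -> /eqP.
  move=> sq nz_q Kq.
  have [dvd|] := classic (forall q', K q' -> q %| q').
    have [w rw] : exists w, root q w.
      apply/closed_rootP; apply: contra_notN K1 => /size_poly1P[c nz_c qE].
      by rewrite -[1]/(1%:P) -(mulVf nz_c) polyCM -qE; exact: KM.
    by exists w => q' /dvd/dvdpP[r ->]; rewrite hornerM (eqP rw) mulr0.
  move=> /not_all_ex_not[q' /(imply_to_and (K q'))[Kq' ndvd]].
  apply: (IH (q' %% q)).
  - by rewrite -ltnS (leq_trans _ sq) // ltn_modp.
  - by apply/negP.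
  - have -> : q' %% q = q' + (- (q' %/ q)) * q.
      by rewrite {2}(divp_eq q' q) mulNr addrAC subrr add0r.
    by apply: KD => //; exact: KM.
have [[q [nz_q Kq]]|noq] := classic (exists q, q != 0 /\ K q).
  exact: step (leqnn _) nz_q Kq.
exists 0 => q Kq; have [->|nz_q] := eqVneq q 0; first by rewrite horner0.
by case: noq; exists q.
Qed.

(** The hypotheses on the leading coefficients preserve both sizes, hence the shape of the Sylvester
    matrix. *)
Lemma resultant_map (aR rR : comNzRingType) (f : {rmorphism aR -> rR})
    (p q : {poly aR}) :
  f (lead_coef p) != 0 -> f (lead_coef q) != 0 ->
  f (resultant p q) = resultant (map_poly f p) (map_poly f q).
Proof.
move=> nz_fp nz_fq; rewrite /resultant /Sylvester_mx !size_map_poly_id0 //.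
rewrite -det_map_mx map_col_mx; congr (\det (col_mx _ _));
  by apply: map_lin1_mx => v; rewrite map_poly_rV rmorphM /= map_rVpoly.
Qed.

(** The coefficient is a constant, the value of the top form at (1, [l]): for [l] off its zero set,
    [p] becomes monic in the first variable up to a scalar. *)
Lemma unfold_top (k : comNzRingType) n (l : 'I_n -> k) d (p : {mpoly k[n.+1]}) :
  (msize p <= d.+1)%N ->
  has_top d (unfold l p)
   ((pihomog mdeg d p).@[fun i => if unlift ord0 i is Some j then l j else 1])%:MP.
Proof.
set u := (X in _.@[X]) => sp.
have sv i : (size (unfold_var l i) <= 2)%N.
  rewrite /unfold_var; case: unliftP => [j _|_]; last by rewrite size_polyX.
  apply: leq_trans (size_polyD _ _) _; rewrite geq_max (leq_trans (size_polyC_leq1 _)) //=.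
  apply: leq_trans (size_polyMleq _ _) _; rewrite size_polyX addn2 /=.
  by rewrite ltnS size_polyC_leq1.
have := mmap_top (@mpolyC n k) sv sp; rewrite -/(unfold l p) => -[st tt]; split=> //.
rewrite tt; apply: (mpoly_rmorph_eq (f := mmap (@mpolyC n k) _)
   (g := @mpolyC n k \o meval u)) => [c|i] /=; first by rewrite mmapC mevalC.
rewrite mmapX mmap1U mevalXU /u /unfold_var; case: unliftP => [j _|_].
  by rewrite coefD coefC add0r coefCM coefX mulr1.
by rewrite coefX mpolyC1.
Qed.

(* Arrondo's proof: after a linear substitution [J] contains a [P0] monic in
   'X_0 up to a constant; over a zero [v] of the elimination ideal, an element
   [h] of [J] reducing to 1 would give a resultant in the elimination ideal that
   does not vanish at [v]. Adding a multiple of [P0] to [h] makes its leading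
   coefficient constant, so that the resultant commutes with evaluation. *)
Lemma weak_nullstellensatz (k : closedFieldType) n (J : {mpoly k[n]} -> Prop) :
  ideal_closed J -> ~ J 1 -> exists v, forall f, J f -> f.@[v] = 0.
Proof.
elim: n J => [|n IH] J [J0 JD JM] J1.
  exists (fun=> 0) => f Jf; have [->|nz_f] := eqVneq f 0; first by rewrite meval0.
  have [v fv] := mpoly_nonvanish nz_f.
  have fC : f = (f@_0)%:MP.
    apply: msize1_polyC; rewrite msizeE; apply/bigmax_leqP_seq => m _ _; rewrite ltnS.
    by rewrite /mdeg big_tuple big_ord0.
  move: fv; rewrite fC mevalC => nzc; case: J1.
  have -> : 1 = (f@_0)^-1%:MP * f by rewrite {2}fC -mpolyCM mulVf.
  exact: JM.
have [[f [nz_f Jf]]|noq] := classic (exists f, f != 0 /\ J f); last first.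
  exists (fun=> 0) => f Jf; have [->|nz_f] := eqVneq f 0; first by rewrite meval0.
  by case: noq; exists f.
pose d := (msize f).-1.
have sf : msize f = d.+1 by rewrite /d prednK // lt0n msize_poly_eq0.
pose fd := pihomog mdeg d f.
have nz_fd : fd != 0.
  apply/eqP => /(congr1 (mcoeff (mlead f))); rewrite mcoeff0 => /eqP.
  rewrite /fd (pihomogwE _ _ (leqnn _)) raddf_sum /=.
  have lt_m : (mdeg (mlead f) < msize f)%N by rewrite mlead_deg.
  rewrite (bigD1 (BMultinom lt_m)) /=; last by rewrite -eqSS mlead_deg ?sf.
  rewrite big1 => [|m /andP[_ /eqP ne_m]].
    by rewrite addr0 mcoeffZ mcoeffX eqxx mulr1 mleadc_eq0 (negPf nz_f).
  rewrite mcoeffZ mcoeffX; case: eqP => [mE|]; last by rewrite mulr0.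
  by case: ne_m; apply: val_inj.
(* The factor ['X_ord0] makes the first coordinate of [v0] nonzero, so that [v0] can be rescaled to
   the form (1, [l]). *)
have [v0 nz_fv] : exists v, (fd * 'X_ord0).@[v] != 0.
  apply: mpoly_nonvanish; rewrite mulf_eq0 negb_or nz_fd /=.
  by rewrite -msize_poly_eq0 msizeX.
rewrite mevalM mevalXU mulf_eq0 negb_or in nz_fv.
case/andP: nz_fv => nz_fv nz_v0.
pose u i := (v0 ord0)^-1 * v0 i.
have nz_fu : fd.@[u] != 0.
  by rewrite /u (meval_dhomog _ _ (pihomogP _ _ _)) mulf_neq0 // expf_neq0 // invr_eq0.
pose l j := u (lift ord0 j).
pose P0 := unfold l f.
have [sP0 tP0] : has_top d P0 (fd.@[u])%:MP.
  have := unfold_top l (eq_leq sf); rewrite -/fd.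
  congr (has_top d _ _); congr _%:MP; apply: meval_eq => i.
  by case: unliftP => [j ->|->] //; rewrite /u mulVf.
have {}sP0 : size P0 = d.+1.
  apply/eqP; rewrite eqn_leq sP0 /= ltnNge; apply/negP => /leq_sizeP/(_ d (leqnn _)).
  by rewrite tP0 => /eqP; rewrite mpolyC_eq0 (negPf nz_fu).
have lP0 : lead_coef P0 = (fd.@[u])%:MP by rewrite /lead_coef sP0.
have d_gt0 : (0 < d)%N.
  rewrite lt0n; apply/eqP => d0; case: J1.
  have /msize1_polyC fC : (msize f <= 1)%N by rewrite sf d0.
  have -> : 1 = (f@_0)^-1%:MP * f; last exact: JM.
  rewrite {2}fC -mpolyCM mulVf //; apply: contra nz_f => /eqP f0.
  by rewrite fC f0 mpolyC0.
pose J' P := J (refold l P).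
have J'P0 : J' P0 by rewrite /J' unfoldK.
have J'D p q : J' p -> J' q -> J' (p + q) by rewrite /J' rmorphD; exact: JD.
have J'M p q : J' q -> J' (p * q) by rewrite /J' rmorphM; exact: JM.
have [v hv] : exists v, forall g, J' g%:P -> g.@[v] = 0.
  apply: IH; last by rewrite /J' rmorph1.
  split=> [|p q|p q]; first by rewrite /J' rmorph0.
    by rewrite polyCD; exact: J'D.
  by rewrite polyCM; exact: J'M.
pose K q := exists2 P, J' P & map_poly (meval v) P = q.
have [w hw] : exists w, forall q, K q -> q.[w] = 0.
  apply: poly_ideal_root => [|[h J'h h1]].
    split=> [|_ _ [p Jp <-] [q Jq <-]|p _ [q Jq <-]].
    - by exists 0; rewrite /J' ?rmorph0.
    - by exists (p + q); rewrite ?rmorphD //; exact: J'D.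
    exists (map_poly (@mpolyC n k) p * q); first exact: J'M.
    rewrite rmorphM /= -map_poly_comp map_poly_id // => c _ /=.
    by rewrite mevalC.
  pose h' := h + 'X^(size h) * P0.
  have J'h' : J' h' by apply: J'D => //; exact: J'M.
  have sXP : size ('X^(size h) * P0) = (d + size h).+1.
    by rewrite mulrC size_Mmonic ?monicXn -?size_poly_eq0 ?sP0 // size_polyXn addnS.
  have sh' : size h' = (d + size h).+1.
    by rewrite /h' addrC size_polyDl sXP // ltnS leq_addl.
  have lh' : lead_coef h' = (fd.@[u])%:MP.
    rewrite /h' addrC lead_coefDl ?sXP ?ltnS ?leq_addl //.
    by rewrite mulrC lead_coef_Mmonic ?monicXn.
  have sP0' : (1 < size P0)%N by rewrite sP0.
  have sh'' : (1 < size h')%N by rewrite sh' ltnS addn_gt0 d_gt0.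
  have [[a b] /= _ rE] := resultant_in_ideal sP0' sh''.
  have /hv : J' (resultant P0 h')%:P by rewrite rE; apply: J'D; exact: J'M.
  rewrite resultant_map ?lP0 ?lh' /= ?mevalC // => /eqP.
  rewrite resultant_eq0 => /gtn_eqF; rewrite [_ == 1%N](_ : _ = true) //.
  have -> : map_poly (meval v) h' = 1 + 'X^(size h) * map_poly (meval v) P0.
    by rewrite rmorphD rmorphM /= h1 map_polyXn.
  rewrite -/(coprimep _ _) coprimep_sym -(coprimep_modl _ (map_poly _ _)).
  by rewrite modpD modp_mull addr0 coprimep_modl coprime1p.
exists (fun i => if unlift ord0 i is Some j then v j + l j * w else w) => g Jg.
by rewrite -unfold_eval hw //; exists (unfold l g); rewrite /J' ?unfoldK.
Qed.

(** * Noetherianity *)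

Lemma seq_choice (T U : eqType) (R : T -> U -> Prop) (s : seq T) :
  (forall x, x \in s -> exists y, R x y) ->
  exists t : seq U, (forall x, x \in s -> exists2 y, y \in t & R x y) /\
                    (forall y, y \in t -> exists2 x, x \in s & R x y).
Proof.
elim: s => [|x s IH] hs; first by exists [::].
have [|t [h1 h2]] := IH; first by move=> z zs; apply: hs; rewrite inE zs orbT.
have [y Rxy] := hs x (mem_head _ _).
exists (y :: t); split=> z; rewrite inE => /orP[/eqP->|zs].
- by exists y; rewrite ?mem_head.
- by have [u ut Ru] := h1 z zs; exists u; rewrite // inE ut orbT.
- by exists x; rewrite ?mem_head.
- by have [u us Ru] := h2 z zs; exists u; rewrite // inE us orbT.
Qed.

Lemma dickson n (P : 'X_{1..n} -> Prop) :
  exists s : seq 'X_{1..n}, (forall m, m \in s -> P m) /\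
    forall m, P m -> exists2 m', m' \in s & (m' <= m)%MM.
Proof.
(* Only the first [j] coordinates are compared, which allows induction on [j]. *)
suff H j : forall P : 'X_{1..n} -> Prop,
    exists s : seq 'X_{1..n}, (forall m, m \in s -> P m) /\
    forall m, P m -> exists2 m', m' \in s & forall i : 'I_n, (i < j)%N -> (m' i <= m i)%N.
  have [s [sP hs]] := H n P; exists s; split=> // m /hs[m' m's le]; exists m' => //.
  by apply/mnm_lepP => i; exact: le.
elim: j => {P} [|j IH] P.
  have [[m0 Pm0]|noP] := classic (exists m, P m).
    by exists [:: m0]; split=> [m|m _]; [rewrite inE => /eqP->|exists m0; rewrite ?mem_head].
  by exists [::]; split=> // m Pm; case: noP; exists m.
have [le_nj|lt_jn] := leqP n j.
  have [s [sP hs]] := IH P; exists s; split=> // m /hs[m' m's le]; exists m' => // i _.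
  by apply: le; exact: leq_trans (ltn_ord i) le_nj.
pose i0 := Ordinal lt_jn.
have [s [sP hs]] := IH P.
(* Above the maximum of coordinate [j] over [s], the list [s] itself suffices; the finitely many
   smaller values are treated one at a time with the induction hypothesis. *)
have [t [tP ht]] : exists t : seq 'X_{1..n}, (forall m, m \in t -> P m) /\
    forall m, P m -> (m i0 < \max_(m' <- s) m' i0)%N ->
    exists2 m', m' \in t & forall i : 'I_n, (i < j.+1)%N -> (m' i <= m i)%N.
  elim: (\max_(_ <- _) _)%N => [|M [t [tP ht]]]; first by exists [::]; split.
  have [u [uP hu]] := IH (fun m => P m /\ m i0 = M).
  exists (u ++ t); split=> [m|m Pm]; first by rewrite mem_cat => /orP[/uP[]|/tP].
  rewrite ltnS leq_eqVlt => /orP[/eqP mM|/(ht m Pm)[m' m't le]].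
    have [m' m'u le] := hu m (conj Pm mM); exists m'; first by rewrite mem_cat m'u.
    move=> i; rewrite ltnS leq_eqVlt => /orP[/eqP ij|]; last exact: le.
    have -> : i = i0 by exact: val_inj.
    by have [_ ->] := uP _ m'u; rewrite mM.
  by exists m'; rewrite // mem_cat m't orbT.
exists (s ++ t); split=> [m|m Pm]; first by rewrite mem_cat => /orP[/sP|/tP].
have [lt|ge] := ltnP (m i0) (\max_(m' <- s) m' i0).
  by have [m' m't le] := ht m Pm lt; exists m'; rewrite // mem_cat m't orbT.
have [m' m's le] := hs m Pm; exists m'; first by rewrite mem_cat m's.
move=> i; rewrite ltnS leq_eqVlt => /orP[/eqP ij|]; last exact: le.
have -> : i = i0 by exact: val_inj.
by apply: leq_trans ge; exact: (leq_bigmax_seq (F := fun m0 : 'X_{1..n} => m0 i0) m').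
Qed.

(** Dickson's lemma on leading monomials, followed by division: a multiple of a member of [s]
    cancels the leading term of [f], and monomial orders are well-founded. *)
Lemma hilbert_basis_zeros (k : fieldType) n (J : {mpoly k[n]} -> Prop) :
  ideal_closed J ->
  exists s : seq {mpoly k[n]}, (forall g, g \in s -> J g) /\
    forall f v, J f -> (forall g, g \in s -> g.@[v] = 0) -> f.@[v] = 0.
Proof.
move=> [J0 JD JM].
have [ms [msP hms]] := dickson (fun m => exists f, [/\ J f, f != 0 & mlead f = m]).
have [s [h1 h2]] := seq_choice msP.
exists s; split=> [g /h2[m _ []]|] //.
move=> f v; elim/mleadrect: f => f IH Jf sv.
have [->|nz_f] := eqVneq f 0; first by rewrite meval0.
have [m mms le_m] := hms _ (ex_intro _ f (And3 Jf nz_f erefl)).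
have [g gs [Jg nz_g lg]] := h1 m mms.
pose q : {mpoly k[n]} := (mleadc f / mleadc g) *: 'X_[mlead f - m].
pose f' := f - q * g.
have Jf' : J f' by rewrite /f' -mulNr; apply: JD => //; exact: JM.
have -> : f = f' + q * g by rewrite subrK.
rewrite mevalD mevalM (sv g gs) mulr0 addr0.
have nzc : mleadc f / mleadc g != 0 by rewrite mulf_neq0 ?invr_eq0 ?mleadc_eq0.
have nz_q : q != 0 by rewrite scaler_eq0 negb_or nzc -msize_poly_eq0 msizeX.
have lqg : mlead (q * g) = mlead f.
  by rewrite mleadM // mleadZ // mleadXm lg submK.
have [->|nz_f'] := eqVneq f' 0; first by rewrite meval0.
apply: IH => //; rewrite lt_neqAle; apply/andP; split.
  apply/eqP => lf; have := mleadc_eq0 f'; rewrite lf (negPf nz_f') mcoeffB.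
  rewrite /q -scalerAl mcoeffZ ['X_[_] * g]mulrC -{3}(submK le_m) mcoeffMX.
  by rewrite -lg divfK ?subrr ?eqxx // mleadc_eq0.
apply: le_trans (mleadB_le _ _) _; by rewrite lqg joinxx.
Qed.

(** The union of the chain is an ideal, and the finite list controlling its zeros already lies in
    one [J i]. *)
Lemma ideal_chain_zeros (k : fieldType) n (J : nat -> {mpoly k[n]} -> Prop) :
  (forall i, ideal_closed (J i)) -> (forall i f, J i f -> J i.+1 f) ->
  exists i, forall f v, J i.+1 f -> (forall g, J i g -> g.@[v] = 0) -> f.@[v] = 0.
Proof.
move=> idJ incJ.
have mono i j f : (i <= j)%N -> J i f -> J j f.
  move=> /subnK<- Jf; elim: (j - i)%N => [|e IH] //; exact: incJ.
have idU : ideal_closed (fun f => exists i, J i f).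
  split=> [|f g [i Jf] [j Jg]|f g [i Jg]].
  - by exists 0%N; case: (idJ 0%N).
  - exists (maxn i j); case: (idJ (maxn i j)) => _ JD _.
    by apply: JD; [apply: mono Jf|apply: mono Jg]; rewrite ?leq_maxl ?leq_maxr.
  - by exists i; case: (idJ i) => _ _ JM; exact: JM.
have [s [sJ hs]] := hilbert_basis_zeros idU.
have [i hi] : exists i, forall g, g \in s -> J i g.
  elim: s sJ {hs} => [|g s IH] sJ; first by exists 0%N.
  have [|i hi] := IH; first by move=> h hs; apply: sJ; rewrite inE hs orbT.
  have [j hj] := sJ g (mem_head _ _).
  exists (maxn i j) => h; rewrite inE => /orP[/eqP->|/hi].
    by apply: mono hj; rewrite leq_maxr.
  by apply: mono; rewrite leq_maxl.
exists i => f v Jf zv; apply: hs => [|g gs]; first by exists i.+1.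
by apply: zv; exact: hi.
Qed.

(** * Closed sets and pencils of linear forms *)

Section LinearForms.
Variables (k : fieldType) (N : nat).
Implicit Types a b v : vec k N.

Definition dotv a v : k := \sum_(j < N.+1) a j * v j.

Definition linp a : {mpoly k[N.+1]} := \sum_(j < N.+1) a j *: 'X_j.

Lemma linp_eval a v : (linp a).@[v] = dotv a v.
Proof. by rewrite raddf_sum; apply: eq_bigr => j _; rewrite /= mevalZ mevalXU. Qed.

Lemma dhomogXU (j : 'I_N.+1) : ('X_j : {mpoly k[N.+1]}) \is 1.-homog.
Proof. by rewrite dhomogX /= mdeg1. Qed.

Lemma linp_homog a : linp a \is 1.-homog.
Proof. by apply: rpred_sum => j _; apply/rpredZ/dhomogXU. Qed.

Lemma dotv_scale c a v : dotv a (fun j => c * v j) = c * dotv a v.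
Proof. by rewrite mulr_sumr; apply: eq_bigr => j _; rewrite mulrCA. Qed.

Lemma linp_neq0 a j : a j != 0 -> linp a != 0.
Proof.
apply: contraNneq => /(congr1 (meval (fun i => (i == j)%:R))).
rewrite linp_eval meval0 /dotv (bigD1 j) //= eqxx mulr1 big1 ?addr0; first by move->.
by move=> i /negPf->; rewrite mulr0.
Qed.

End LinearForms.

(** Forms vanishing at [p] are obtained by composing any form [u] with the projection [pr] along
    [p]; the conditions on the points say that a product of nonzero linear forms in [u] does not
    vanish. *)
Lemma linear_form_avoiding (k : closedFieldType) N (p : vec k N) (ys : list (vec k N)) :
  (forall y, List.In y ys -> forall c, exists j, y j != c * p j) ->
  exists a, dotv a p = 0 /\ forall y, List.In y ys -> dotv a y != 0.
Proof.
move=> ys_p.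
(* The zero vector is allowed for [p]: then [p i = 0], and [pr] is the identity. *)
have [i hi] : exists i, p i = 0 -> forall j, p j = 0.
  have [[i /eqP nz]|p0] := classic (exists i, p i != 0); first by exists i => /nz.
  by exists ord0 => _ j; apply/eqP; apply: contra_notT p0 => nz; exists j.
pose pr (y : vec k N) : vec k N := fun j => y j - (y i / p i) * p j.
have nz_prod : List.fold_right (fun y f => linp (pr y) * f) 1 ys != 0.
  elim: ys ys_p => [|y ys IH] ys_p /=; first exact: oner_neq0.
  have [j nz] := ys_p y (or_introl erefl) (y i / p i).
  rewrite mulf_neq0 ?(@linp_neq0 _ _ _ j) ?subr_eq0 //.
  by apply: IH => z hz; apply: ys_p; right.
have [u nz_u] := mpoly_nonvanish nz_prod.
pose a : vec k N := fun j => u j - (j == i)%:R * (dotv u p / p i).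
have aE y : dotv a y = dotv u (pr y).
  rewrite /dotv /a /pr.
  under eq_bigr do rewrite mulrBl.
  under [RHS]eq_bigr do rewrite mulrBr.
  rewrite !sumrB; congr (_ - _); rewrite (bigD1 i) //= eqxx mul1r big1 => [|j /negPf->].
    rewrite addr0 /dotv !mulr_suml; apply: eq_bigr => j _; rewrite -!mulrA.
    by congr (_ * _); rewrite [LHS]mulrC -mulrA mulrCA.
  by rewrite !mul0r.
exists a; split=> [|y].
  rewrite aE /pr /dotv big1 // => j _; have [p0|nz] := eqVneq (p i) 0.
    by rewrite (hi p0 j) mulr0 subr0 mulr0.
  by rewrite divff // mul1r subrr mulr0.
have -> : dotv a y = (linp (pr y)).@[u].
  by rewrite aE linp_eval; apply: eq_bigr => j _; rewrite mulrC.
elim: ys nz_u {ys_p nz_prod} => [|z ys IH] //=.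
rewrite mevalM mulf_eq0 negb_or => /andP[nz1 nz2] [<-|] //; exact: IH.
Qed.

Section Zariski.
Variables (k : fieldType) (N : nat).
Implicit Types Y Z : pset k N.

Lemma zclosed_nonzero Z v : zclosed Z -> Z v -> nonzero v.
Proof. by case=> S [_ ZE] /ZE[]. Qed.

Lemma zclosed_scale Z v w c :
  zclosed Z -> c != 0 -> (forall j, w j = c * v j) -> Z v -> Z w.
Proof.
move=> [S [homS ZE]] nz_c wE /ZE[[j nz_v] Sv]; apply/ZE; split.
  by exists j; rewrite wE mulf_neq0.
move=> p Sp; have [d hd] := homS p Sp.
by rewrite (meval_eq _ wE) (meval_dhomog _ _ hd) Sv ?mulr0.
Qed.

Lemma zclosedI Y Z : zclosed Y -> zclosed Z -> zclosed (fun v => Y v /\ Z v).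
Proof.
move=> [S [homS YE]] [T [homT ZE]]; exists (fun p => S p \/ T p); split.
  by move=> p [/homS|/homT].
move=> v; split=> [[/YE[nz Sv] /ZE[_ Tv]]|[nz STv]].
  by split=> // p [/Sv|/Tv].
by split; [apply/YE|apply/ZE]; split=> // p hp; apply: STv; [left|right].
Qed.

Lemma zclosed_zeros (p : {mpoly k[N.+1]}) d :
  p \is d.-homog -> zclosed (fun v => nonzero v /\ p.@[v] = 0).
Proof.
move=> hp; exists (eq p); split=> [_ <-|v]; first by exists d.
by split=> [[nz pv]|[nz hv]]; split=> //; [move=> _ <-|exact: hv].
Qed.

Definition ppoint (y : vec k N) : pset k N := fun v => nonzero v /\ proj_eq v y.

Lemma ppoint_zclosed y : nonzero y -> zclosed (ppoint y).
Proof.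
move=> [j0 nz_y].
exists (fun p => exists i j, p = y j *: 'X_i - y i *: 'X_j); split.
  move=> _ [i [j ->]]; exists 1%N.
  by rewrite rpredB //; apply: rpredZ; exact: dhomogXU.
move=> v; split=> [[nz_v [c [nz_c vE]]]|[[i nz_v] hv]].
  split=> // _ [i [j ->]]; rewrite mevalB !mevalZ !mevalXU !vE.
  by rewrite mulrCA [y i * _]mulrCA [y j * _]mulrC subrr.
have vE j : v j = (v j0 / y j0) * y j.
  have := hv _ (ex_intro _ j (ex_intro _ j0 erefl)).
  rewrite mevalB !mevalZ !mevalXU => /eqP; rewrite subr_eq0 => /eqP e.
  by rewrite mulrAC [v j0 * _]mulrC -e mulrAC divff // mul1r.
split; first by exists i.
exists (v j0 / y j0); split=> //; apply: contraNneq nz_v => e.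
by rewrite vE e mul0r.
Qed.

Lemma ppoint_irreducible y : nonzero y -> irreducible_closed (ppoint y).
Proof.
move=> nz_y; have yy : ppoint y y by split=> //; exists 1; split=> [|j]; rewrite ?oner_eq0 ?mul1r.
split; first exact: ppoint_zclosed.
split; first by exists y.
by move=> Y Z cY cZ YZ; case: (YZ y yy) => h; [left|right] => v [_ [c [nz_c vE]]];
  exact: (zclosed_scale _ nz_c vE h).
Qed.

(** Noetherian induction: dependent choice would produce a strictly decreasing sequence of closed
    sets, while the zeros of their vanishing ideals must repeat. *)
Lemma zclosed_noetherian (B : pset k N -> Prop) :
  (forall Y, zclosed Y -> B Y -> exists Y',
     zclosed Y' /\ B Y' /\ Defs.subsetP Y' Y /\ ~ Defs.subsetP Y Y') ->
  forall Y, zclosed Y -> ~ B Y.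
Proof.
move=> step Y0 cY0 BY0.
pose T := {Y | zclosed Y /\ B Y}.
have nextP (t : T) : exists t' : T,
    Defs.subsetP (sval t') (sval t) /\ ~ Defs.subsetP (sval t) (sval t').
  case: t => Y [cY BY]; have [Y' [cY' [BY' h]]] := step Y cY BY.
  by exists (exist _ Y' (conj cY' BY')).
pose next t := sval (constructive_indefinite_description _ (nextP t)).
have nextE t : Defs.subsetP (sval (next t)) (sval t) /\ ~ Defs.subsetP (sval t) (sval (next t)).
  by rewrite /next; case: constructive_indefinite_description.
pose seqY i := iter i next (exist _ Y0 (conj cY0 BY0) : T).
pose J i (f : {mpoly k[N.+1]}) := forall v, sval (seqY i) v -> f.@[v] = 0.
have [i|i f Jf v|i hi] := @ideal_chain_zeros k _ J.
- split=> [v _|f g Jf Jg v Yv|f g Jg v Yv]; first by rewrite meval0.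
    by rewrite mevalD Jf ?Jg ?addr0.
  by rewrite mevalM Jg ?mulr0.
- by rewrite /seqY iterS => /(proj1 (nextE _)); exact: Jf.
case: (nextE (seqY i)) => _; apply=> v Yv.
have [[S [homS YE]] _] := svalP (next (seqY i)); apply/YE; split.
  by apply: zclosed_nonzero Yv; case: (svalP (seqY i)).
move=> p Sp; apply: (hi p v) => [w|g Jg]; last exact: Jg.
by rewrite /seqY iterS => /YE[_]; exact.
Qed.

Definition finite_points Y : Prop :=
  exists z : list (vec k N), (forall y, List.In y z -> Y y) /\
    forall v, Y v -> exists y, List.In y z /\ proj_eq v y.

(** An infinite closed subset cannot be irreducible, since it would be a single point; of the two
    proper closed pieces covering it, one is infinite again. *)
Lemma finite_zero_dimensional Y :
  zclosed Y ->
  (forall Z y, irreducible_closed Z -> Defs.subsetP Z Y -> Z y -> Defs.subsetP Z (ppoint y)) ->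
  finite_points Y.
Proof.
move=> cY dimY; apply: NNPP => infY.
apply: (@zclosed_noetherian (fun Z => Defs.subsetP Z Y /\ ~ finite_points Z)
         _ Y cY (conj (fun v h => h) infY)) => {}Z cZ [ZY infZ].
have [[y Zy]|noZ] := classic (exists y, Z y); last first.
  by case: infZ; exists nil; split=> // v Zv; case: noZ; exists v.
have nirr : ~ irreducible_closed Z.
  move=> irrZ; case: infZ; exists (cons y nil); split=> [_ [<-|[]]|v Zv] //.
  by exists y; split; [left|case: (dimY Z y irrZ ZY Zy v Zv)].
have [Z1 [Z2 [cZ1 [cZ2 [Z12 [n1 n2]]]]]] : exists Z1 Z2, zclosed Z1 /\ zclosed Z2 /\
    (forall v, Z v -> Z1 v \/ Z2 v) /\ ~ Defs.subsetP Z Z1 /\ ~ Defs.subsetP Z Z2.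
  apply: NNPP => no; apply: nirr; split=> //; split; first by exists y.
  move=> Z1 Z2 cZ1 cZ2 Z12; apply: NNPP => /not_or_and[n1 n2].
  by apply: no; exists Z1, Z2.
have [f1|f1] := classic (finite_points (fun v => Z v /\ Z1 v)); last first.
  exists (fun v => Z v /\ Z1 v); split; first exact: zclosedI.
  by split; [split=> // v [/ZY]|split=> [v []|h] //; apply: n1 => v /h[]].
have [f2|f2] := classic (finite_points (fun v => Z v /\ Z2 v)); last first.
  exists (fun v => Z v /\ Z2 v); split; first exact: zclosedI.
  by split; [split=> // v [/ZY]|split=> [v []|h] //; apply: n2 => v /h[]].
case: infZ; have [z1 [h1 g1]] := f1; have [z2 [h2 g2]] := f2.
exists (z1 ++ z2)%list; split=> [u huz|v Zv].
  by case: (List.in_app_or _ _ _ huz) => [/h1[]|/h2[]].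
case: (Z12 v Zv) => hv; [have [u [uz e]] := g1 v (conj Zv hv)|have [u [uz e]] := g2 v (conj Zv hv)];
  by exists u; split=> //; apply: List.in_or_app; tauto.
Qed.

End Zariski.

(** Take [b] through [p] but not through some point of [X]. Its section of [X] is finite, as a
    larger irreducible subset would give a chain of length 2 in [X]; then take [a] through [p]
    avoiding the section. *)
Lemma pencil_exists (k : closedFieldType) N (X : pset k N) p :
  irreducible_curve X -> ~ X p ->
  exists a b, [/\ dotv a p = 0, dotv b p = 0, exists2 x, X x & dotv b x != 0
    & forall x, X x -> dotv b x = 0 -> dotv a x != 0].
Proof.
move=> [irrX [_ nochain]] nXp; have [cX [[x0 Xx0] _]] := irrX.
have offp x : X x -> forall c, exists j, x j != c * p j.
  move=> Xx c; apply: NNPP => no; apply: nXp.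
  have xE j : x j = c * p j.
    by apply/eqP; apply: contra_notT no => nz; exists j.
  have [i nz_x] := zclosed_nonzero cX Xx.
  have nz_c : c != 0 by apply: contraNneq nz_x => c0; rewrite xE c0 mul0r.
  apply: (zclosed_scale (c := c^-1)) Xx; rewrite ?invr_eq0 // => j.
  by rewrite xE mulKf.
have [|b [bp bx0]] := @linear_form_avoiding k N p (cons x0 nil).
  by move=> y [<-|[]]; exact: offp.
have {}bx0 : dotv b x0 != 0 by apply: bx0; left.
pose Y v := X v /\ (nonzero v /\ (linp b).@[v] = 0).
have [||z [zY hz]] := @finite_zero_dimensional k N Y.
- by apply: zclosedI => //; exact: zclosed_zeros (linp_homog b).
- move=> Z y irrZ ZY Zy; apply: NNPP => ns; apply: nochain.
  have [cZ _] := irrZ; have nz_y := zclosed_nonzero cZ Zy.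
  exists (fun i => if i is 0%N then ppoint y else if i is 1%N then Z else X); split.
    by move=> [|[|i]] _ //; exact: ppoint_irreducible.
  split=> //; case=> [|[|i]] // _; split=> //.
  - by move=> v [_ [c [nz_c vE]]]; exact: (zclosed_scale cZ nz_c vE Zy).
  - by move=> v /ZY[].
  - move=> XZ; have [_ [_]] := ZY _ (XZ _ Xx0).
    by rewrite linp_eval => /eqP; rewrite (negPf bx0).
have [|a [ap az]] := @linear_form_avoiding k N p z; first by move=> y /zY[/offp].
exists a, b; split=> //; first by exists x0.
move=> x Xx bx; have [|y [yz [c [nz_c xE]]]] := hz x.
  by split=> //; split; [exact: zclosed_nonzero Xx|rewrite linp_eval].
have -> : dotv a x = c * dotv a y.
  by rewrite -dotv_scale; apply: eq_bigr => j _; rewrite xE.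
by rewrite mulf_neq0 // az.
Qed.

(** * Integrality over a pencil *)

Lemma meval_scale (k : comNzRingType) n (f : {mpoly k[n]}) c v :
  f.@[fun i => c * v i] = \sum_(d < msize f) c ^+ d * (pihomog mdeg d f).@[v].
Proof.
rewrite {1}(pihomog_partitionE (leqnn (msize f))) raddf_sum.
by apply: eq_bigr => d _; rewrite /= (meval_dhomog _ _ (pihomogP _ _ _)).
Qed.

Lemma poly_vanish (k : closedFieldType) (q : {poly k}) : (forall c, q.[c] = 0) -> q = 0.
Proof.
move=> q0; apply/eqP; apply: contraT => /closed_nonrootP[c].
by rewrite rootE q0 eqxx.
Qed.

(** The value is a polynomial in the scale [c] that vanishes everywhere; its coefficients are the
    values of the homogeneous components. *)
Lemma pihomog_vanish (k : closedFieldType) n (f : {mpoly k[n]}) v :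
  (forall c, f.@[fun i => c * v i] = 0) -> forall d, (pihomog mdeg d f).@[v] = 0.
Proof.
move=> f0 d; have [lt_d|ge_d] := ltnP d (msize f); last first.
  suff -> : pihomog mdeg d f = 0 by rewrite meval0.
  rewrite (pihomogwE _ _ (leqnn (msize f))) big1 // => m /eqP md.
  by have := leq_trans (bmdeg m) ge_d; rewrite md ltnn.
pose q := \poly_(i < msize f) (pihomog mdeg i f).@[v].
have -> : (pihomog mdeg d f).@[v] = q`_d by rewrite coef_poly lt_d.
rewrite (_ : q = 0) ?coef0 //; apply: poly_vanish => c.
rewrite horner_poly -[RHS](f0 c) meval_scale; apply: eq_bigr => i _.
by rewrite mulrC.
Qed.

Lemma pihomog_linear_mul (k : comNzRingType) n (A g : {mpoly k[n]}) :
  A \is 1.-homog ->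
  pihomog mdeg 0 (A * g) = 0 /\
  forall d, pihomog mdeg d.+1 (A * g) = A * pihomog mdeg d g.
Proof.
move=> hA; have hAg e : A * pihomog mdeg e g \is e.+1.-homog.
  by rewrite -add1n; apply: dhomogM hA (pihomogP _ _ _).
rewrite {1 2}(pihomog_partitionE (leqnn (msize g))) mulr_sumr; split.
  rewrite raddf_sum big1 //= => e _.
  by apply: (@pihomog_ne0 _ _ _ e.+1) (hAg e).
move=> d; have gE := pihomog_partitionE (leqnn (msize g)).
rewrite [X in _ = A * pihomog _ _ X]gE !raddf_sum mulr_sumr.
apply: eq_bigr => e _ /=; have [<-|ne_ed] := eqVneq (e : nat) d.
  by rewrite (pihomog_dE (hAg e)) pihomog_id.
rewrite (pihomog_ne0 _ (hAg e)) // (@pihomog_ne0 _ _ _ e) ?mulr0 //.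
exact: pihomogP.
Qed.

Section ConeIdeal.
Variables (k : closedFieldType) (N : nat) (X : pset k N).

(* Quantifying over [c] includes the vertex of the cone over [X], so that
   coordinates [c * x j] with [c = 0] need no special treatment. *)
Definition cone_ideal (f : {mpoly k[N.+1]}) : Prop :=
  forall x c, X x -> f.@[fun j => c * x j] = 0.

Lemma cone_ideal_closed : ideal_closed cone_ideal.
Proof.
split=> [x c _|f g If Ig x c Xx|f g Ig x c Xx]; first exact: meval0.
  by rewrite mevalD If ?Ig ?addr0.
by rewrite mevalM Ig ?mulr0.
Qed.

Lemma cone_ideal_pihomog d f : cone_ideal f -> cone_ideal (pihomog mdeg d f).
Proof.
move=> If x c Xx; rewrite (meval_dhomog _ _ (pihomogP _ _ _)).
by rewrite pihomog_vanish ?mulr0 // => e; exact: If.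
Qed.

Variables a b : vec k N.
Hypothesis cX : zclosed X.
Hypothesis noz : forall x, X x -> dotv b x = 0 -> dotv a x != 0.

(** The ideal generated by the two forms and the ideal of the cone; by [noz] its zeros reduce to the
    vertex. *)
Let J f := exists g h, cone_ideal (f - (linp a * g + linp b * h)).

Let J_closed : ideal_closed J.
Proof.
have [I0 ID IM] := cone_ideal_closed.
split.
- by exists 0, 0; rewrite !mulr0 addr0 subrr.
- move=> f f' [g [h e]] [g' [h' e']]; exists (g + g'), (h + h').
  by have := ID _ _ e e'; rewrite !mulrDr addrACA -opprD [in - _]addrACA.
- move=> f f' [g [h e]]; exists (f * g), (f * h).
  by have := IM f _ e; rewrite mulrBr mulrDr ![f * (_ * _)]mulrCA.
Qed.

Let J_cone f : cone_ideal f -> J f.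
Proof. by move=> If; exists 0, 0; rewrite !mulr0 addr0 subr0. Qed.

Let J_pihomog d f : J f -> J (pihomog mdeg d f).
Proof.
move=> [g [h e]]; have := cone_ideal_pihomog d e.
have [a0 aS] := pihomog_linear_mul g (linp_homog a).
have [b0 bS] := pihomog_linear_mul h (linp_homog b).
rewrite raddfB raddfD /=; case: d => [|d].
  by rewrite a0 b0 addr0 subr0; exact: J_cone.
by rewrite aS bS => e'; exists (pihomog mdeg d g), (pihomog mdeg d h).
Qed.

Let J_var j : exists d, J ('X_j ^+ d).
Proof.
have [J0 JD JM] := J_closed.
(* [w] is an inverse of 1 - 'X_j modulo the homogeneous ideal [J], so its
   component of degree d is 'X_j^d modulo [J]; but it vanishes for large d. *)
have [w Jw] : exists w, J (1 - (1 - 'X_j) * w).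
  apply: NNPP => no.
  (* A common zero of [J] and [1 - 'X_j] would have coordinate [j] equal to 1, hence be a point of
     [X] where both forms vanish. *)
  have [||v hv] := @weak_nullstellensatz k _ (fun f => exists w, J (f - (1 - 'X_j) * w)).
  - split; first by exists 0; rewrite mulr0 subr0.
      move=> f g [w Jw] [w' Jw']; exists (w + w').
      by have := JD _ _ Jw Jw'; rewrite mulrDr addrACA -opprD.
    move=> f g [w Jw]; exists (f * w).
    by have := JM f _ Jw; rewrite mulrBr [f * (_ * _)]mulrCA.
  - exact: no.
  have JJ f : J f -> f.@[v] = 0.
    by move=> Jf; apply: hv; exists 0; rewrite mulr0 subr0.
  have vj : v j = 1.
    have : (1 - 'X_j : {mpoly k[N.+1]}).@[v] = 0.
      by apply: hv; exists 1; rewrite mulr1 subrr.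
    by rewrite mevalB meval1 mevalXU => /eqP; rewrite subr_eq0 => /eqP.
  have Xv : X v.
    have [S [homS XE]] := cX; apply/XE; split.
      by exists j; rewrite vj oner_eq0.
    move=> p Sp; apply/JJ/J_cone => x c /XE[_ Sx].
    by have [d hp] := homS p Sp; rewrite (meval_dhomog _ _ hp) Sx ?mulr0.
  have av : dotv a v = 0.
    by rewrite -linp_eval; apply: JJ; exists 1, 0; rewrite mulr1 mulr0 addr0 subrr; case: cone_ideal_closed.
  have bv : dotv b v = 0.
    by rewrite -linp_eval; apply: JJ; exists 0, 1; rewrite mulr1 mulr0 add0r subrr; case: cone_ideal_closed.
  by have := noz Xv bv; rewrite av eqxx.
have hX := dhomogXU k j.
have [X0 XS] := pihomog_linear_mul w hX.
suff H d : J ('X_j ^+ d - pihomog mdeg d w).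
  exists (msize w); have := H (msize w).
  suff -> : pihomog mdeg (msize w) w = 0 by rewrite subr0.
  rewrite (pihomogwE _ _ (leqnn (msize w))) big1 // => m /eqP md.
  by have := bmdeg m; rewrite md ltnn.
have Jd e := J_pihomog e Jw.
elim: d => [|d IH].
  have := Jd 0%N; rewrite mulrBl mul1r !pihomogB X0 subr0.
  by rewrite (pihomog_dE (dhomog1 _ _)).
have -> : 'X_j ^+ d.+1 - pihomog mdeg d.+1 w =
    'X_j * ('X_j ^+ d - pihomog mdeg d w) + ('X_j * pihomog mdeg d w - pihomog mdeg d.+1 w).
  by rewrite exprS mulrBr addrA subrK.
apply: JD; first exact: JM.
have := Jd d.+1; rewrite mulrBl mul1r !pihomogB XS.
by rewrite (pihomog_ne0 _ (dhomog1 _ _)) // sub0r opprB.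
Qed.

(** A monomial of degree above the sum of the [e j] is divisible by some ['X_j ^+ e j], which lies
    in [J]; homogeneous components of the cofactors restore the degree. This is a graded form of
    integrality over [k[a,b]]. *)
Lemma pencil_integral : exists n0, forall n f, (n0 <= n)%N -> f \is n.+1.-homog ->
  exists g h, [/\ g \is n.-homog, h \is n.-homog &
    cone_ideal (f - (linp a * g + linp b * h))].
Proof.
have [J0 JD JM] := J_closed.
pose e j := sval (constructive_indefinite_description _ (J_var j)).
have Je j : J ('X_j ^+ e j) by rewrite /e; case: constructive_indefinite_description.
exists (\sum_j e j)%N => n f le_n hf.
have [g [h Igh]] : J f.
  rewrite (mpolyE f) big_seq; elim/big_rec: _ => // m q mf Jq.
  apply: JD => //; rewrite -mul_mpolyC; apply: (JM).
  have md : mdeg m = n.+1 by apply: (dhomog_mf hf).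
  have [j le_j] : exists j, (e j <= m j)%N.
    apply: NNPP => no; suff: (mdeg m <= \sum_j e j)%N by rewrite md ltnNge le_n.
    rewrite mdegE; apply: leq_sum => j _; rewrite leqNgt; apply/negP => lt_j.
    by apply: no; exists j; exact: ltnW.
  have -> : 'X_[m] = 'X_[m - U_(j) *+ e j] * 'X_j ^+ e j :> {mpoly k[N.+1]}.
    rewrite mpolyXn -mpolyXD submK //; apply/mnm_lepP => i.
    by rewrite mulmnE mnm1E; case: eqP => [<-|]; rewrite ?mul1n ?mul0n.
  exact: JM.
exists (pihomog mdeg n g), (pihomog mdeg n h); split; try exact: pihomogP.
have := cone_ideal_pihomog n.+1 Igh; rewrite raddfB raddfD /= (pihomog_dE hf).
have [_ ->] := pihomog_linear_mul g (linp_homog a).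
by have [_ ->] := pihomog_linear_mul h (linp_homog b).
Qed.

End ConeIdeal.

(** * Sums of points of a curve *)

Lemma mpoly_linear_ind (k : comNzRingType) n (Q : {mpoly k[n]} -> Prop)
    (f : {mpoly k[n]}) :
  Q 0 -> (forall g h, Q g -> Q h -> Q (g + h)) ->
  (forall c g, Q g -> Q (c *: g)) -> (forall m, m \in msupp f -> Q 'X_[m]) -> Q f.
Proof.
move=> Q0 QD QZ QX; rewrite (mpolyE f) big_seq; elim/big_rec: _ => // m q mf Qq.
by apply: (QD) => //; apply: QZ; exact: QX.
Qed.

Section ConeSpan.
Variables (k : closedFieldType) (N : nat) (X : pset k N) (a b : vec k N) (n0 : nat).
Hypothesis integral : forall n f, (n0 <= n)%N -> f \is n.+1.-homog ->
  exists g h, [/\ g \is n.-homog, h \is n.-homog &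
    cone_ideal X (f - (linp a * g + linp b * h))].

(** The cardinal is quadratic in [D], matching the dimension 2 of the affine cone: the generators
    serve all polynomials of degree at most [D], not just forms of one degree. *)
Definition cone_gen_index D : finType := ('I_D.+1 * 'I_D.+1 * 'X_{1..N.+1 < n0.+1})%type.

Definition cone_gen D (t : cone_gen_index D) : {mpoly k[N.+1]} :=
  linp a ^+ t.1.1 * linp b ^+ t.1.2 * 'X_[t.2].

(* The linear span is expressed by quantifying over the subspaces [Q]. *)
Definition submodule (Q : {mpoly k[N.+1]} -> Prop) : Prop :=
  [/\ forall f, cone_ideal X f -> Q f, forall f g, Q f -> Q g -> Q (f + g)
    & forall c f, Q f -> Q (c *: f)].

Definition in_cone_span D (f : {mpoly k[N.+1]}) : Prop :=
  forall Q, submodule Q -> (forall t : cone_gen_index D, Q (cone_gen t)) -> Q f.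

(** Integrality lowers the degree by one at the cost of a factor [linp a] or [linp b], down to [n0];
    the subspace [Q] is pulled back along multiplication by that factor. *)
Lemma in_cone_span_homog n f : f \is n.-homog -> in_cone_span n f.
Proof.
elim: n f => [|n IH] f hf Q [QI QD QZ] Qg; have Q0 := QI 0 (let: And3 I0 _ _ := cone_ideal_closed X in I0).
  apply: mpoly_linear_ind => // m mf.
  have lt_m : (mdeg m < n0.+1)%N by rewrite (dhomog_mf hf mf).
  by have := Qg (ord0, ord0, BMultinom lt_m); rewrite /cone_gen /= !expr0 !mul1r.
have [lt_n|le_n] := ltnP n n0.
  apply: mpoly_linear_ind => // m mf.
  have lt_m : (mdeg m < n0.+1)%N by rewrite (dhomog_mf hf mf).
  by have := Qg (ord0, ord0, BMultinom lt_m); rewrite /cone_gen /= !expr0 !mul1r.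
have [g [h [hg hh Ifgh]]] := integral le_n hf.
rewrite -(subrK (linp a * g + linp b * h) f).
have [I0 ID IM] := cone_ideal_closed X.
apply: (QD); first exact: QI.
apply: (QD).
  apply: (IH g hg (fun q => Q (linp a * q))).
    split=> [q /(IM (linp a))/QI|q q' Qq Qq'|c q Qq] //.
      by rewrite mulrDr; exact: QD.
    by rewrite -scalerAr; exact: QZ.
  move=> [[i j] m].
  have := Qg (lift ord0 i, widen_ord (leqnSn _) j, m).
  by rewrite /cone_gen /= /bump /= add1n exprS !mulrA.
apply: (IH h hh (fun q => Q (linp b * q))).
  split=> [q /(IM (linp b))/QI|q q' Qq Qq'|c q Qq] //.
    by rewrite mulrDr; exact: QD.
  by rewrite -scalerAr; exact: QZ.
move=> [[i j] m].
have := Qg (widen_ord (leqnSn _) i, lift ord0 j, m).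
by rewrite /cone_gen /= /bump /= add1n exprS mulrCA -!mulrA [linp b * (_ * _)]mulrCA.
Qed.

Lemma in_cone_span_mono D D' f : (D <= D')%N -> in_cone_span D f -> in_cone_span D' f.
Proof.
move=> le_D Df Q sQ Qg; apply: Df => // -[[i j] m].
have le_D1 : (D.+1 <= D'.+1)%N by [].
exact: (Qg (widen_ord le_D1 i, widen_ord le_D1 j, m)).
Qed.

Lemma cone_span D f : (msize f <= D.+1)%N ->
  exists kappa : cone_gen_index D -> k,
    cone_ideal X (f - \sum_t kappa t *: cone_gen t).
Proof.
move=> sf; have [I0 ID IM] := cone_ideal_closed X.
have : in_cone_span D f.
  move=> Q sQ Qg; have [QI QD QZ] := sQ.
  rewrite (pihomog_partitionE sf); elim/big_rec: _ => [|d q _ Qq]; first exact: QI.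
  have le_d : (d <= D)%N by rewrite -ltnS.
  by apply: (QD) => //; exact: (in_cone_span_mono le_d (in_cone_span_homog (pihomogP _ _ _))).
move=> spf; apply: (spf (fun f => exists kappa : cone_gen_index D -> k,
    cone_ideal X (f - \sum_t kappa t *: cone_gen t))).
- split=> [g Ig|g h [u Iu] [w Iw]|c g [u Iu]].
  + by exists (fun=> 0); rewrite big1 ?subr0 // => t _; rewrite scale0r.
  + exists (fun t => u t + w t); have := ID _ _ Iu Iw.
    rewrite addrACA -opprD -big_split /=; congr (cone_ideal X (_ - _)).
    by apply: eq_bigr => t _; rewrite scalerDl.
  + exists (fun t => c * u t); have := IM c%:MP _ Iu.
    rewrite mul_mpolyC scalerBr scaler_sumr; congr (cone_ideal X (_ - _)).
    by apply: eq_bigr => t _; rewrite scalerA.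
- move=> t; exists (fun t' => (t' == t)%:R).
  rewrite (bigD1 t) //= eqxx scale1r big1 ?addr0 ?subrr // => t' /negPf->.
  by rewrite scale0r.
Qed.

Section SumOfPoints.
Variable s : nat.
Implicit Types Phi Psi : ('I_s -> vec k N) -> k.

Definition fun_submodule (Q : (('I_s -> vec k N) -> k) -> Prop) : Prop :=
  [/\ forall Phi Psi, Phi =1 Psi -> Q Phi -> Q Psi, Q (fun=> 0),
      forall Phi Psi, Q Phi -> Q Psi -> Q (fun y => Phi y + Psi y)
    & forall c Phi, Q Phi -> Q (fun y => c * Phi y)].

(** Degree at most [d] in each of the [s] vectors separately: the [s]-fold tensor power of the
    polynomials of degree at most [d]. *)
Definition multi_deg d Phi : Prop :=
  forall Q, fun_submodule Q ->
  (forall f : 'I_s -> {mpoly k[N.+1]}, (forall i, (msize (f i) <= d.+1)%N) ->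
     Q (fun y => \prod_i (f i).@[y i])) -> Q Phi.

Lemma multi_deg_mono d e Phi : (d <= e)%N -> multi_deg d Phi -> multi_deg e Phi.
Proof.
move=> le_de dPhi Q sQ Qf; apply: dPhi => // f sf; apply: Qf => i.
exact: leq_trans (sf i) _.
Qed.

Lemma multi_deg1 : multi_deg 0 (fun=> 1).
Proof.
move=> Q [Qe _ _ _] Qf; apply: Qe (Qf (fun=> 1) _) => [y|i]; last by rewrite msize1.
by rewrite big1 // => i _; rewrite meval1.
Qed.

Lemma multi_deg_linear d Phi l :
  multi_deg d Phi ->
  multi_deg d.+1 (fun y => dotv l (fun j => \sum_i y i j) * Phi y).
Proof.
move=> dPhi Q [Qe Q0 QD QZ] Qf.
suff H i : Q (fun y => dotv l (y i) * Phi y).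
  have : Q (fun y => \sum_i (dotv l (y i) * Phi y)).
    elim: (index_enum _) => [|i r IH].
      by apply: Qe Q0 => y; rewrite big_nil.
    by apply: Qe (QD _ _ (H i) IH) => y; rewrite big_cons.
  apply: Qe => y; rewrite -mulr_suml; congr (_ * _); rewrite exchange_big /=.
  by apply: eq_bigr => j _; rewrite mulr_sumr.
apply: (dPhi (fun Psi => Q (fun y => dotv l (y i) * Psi y))).
  split=> [P1 P2 P12|||].
  - by apply: Qe => y; rewrite P12.
  - by apply: Qe Q0 => y; rewrite mulr0.
  - by move=> P1 P2 Q1 Q2; apply: Qe (QD _ _ Q1 Q2) => y; rewrite mulrDr.
  - by move=> c P QP; apply: Qe (QZ c _ QP) => y; rewrite mulrCA.
move=> f sf; pose g i' := if i' == i then linp l * f i' else f i'.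
apply: Qe (Qf g _) => [y|].
  rewrite (bigD1 i) //= [in RHS](bigD1 i) //= mulrA; congr (_ * _).
    by rewrite /g eqxx mevalM linp_eval.
  by apply: eq_bigr => i' /negPf ne; rewrite /g ne.
move=> i'; rewrite /g; case: eqP => _; last exact: leq_trans (sf i') _.
have [->|nz_l] := eqVneq (linp l) 0; first by rewrite mul0r msize0.
have [->|nz_f] := eqVneq (f i') 0; first by rewrite mulr0 msize0.
have sl : (msize (linp l) <= 2)%N.
  by rewrite msizeE; apply/bigmax_leqP_seq => m ml _; rewrite (dhomog_mf (linp_homog l) ml).
rewrite msizeM //; have := leq_add sl (sf i').
by rewrite addSn add1n; case: (_ + _)%N.
Qed.

Lemma multi_deg_prod n (l : 'I_n -> vec k N) E (e : {ffun 'I_n -> 'I_E.+1}) :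
  multi_deg (n * E) (fun y => \prod_r dotv (l r) (fun j => \sum_i y i j) ^+ e r).
Proof.
have Me Phi Psi d : Phi =1 Psi -> multi_deg d Phi -> multi_deg d Psi.
  by move=> PP dP Q sQ Qf; have [Qe _ _ _] := sQ; apply: Qe PP _; exact: dP.
have : multi_deg (\sum_r e r)
    (fun y => \prod_r dotv (l r) (fun j => \sum_i y i j) ^+ e r).
  elim: (index_enum _) => [|r rs IH].
    by rewrite big_nil; apply: Me multi_deg1 => y; rewrite big_nil.
  suff H d : multi_deg (d + \sum_(r <- rs) e r) (fun y =>
      dotv (l r) (fun j => \sum_i y i j) ^+ d *
      \prod_(r <- rs) dotv (l r) (fun j => \sum_i y i j) ^+ e r).
    by rewrite big_cons; apply: Me (H (e r)) => y; rewrite big_cons.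
  elim: d => [|d IHd]; first by apply: Me IH => y; rewrite expr0 mul1r.
  by apply: Me (multi_deg_linear (l r) IHd) => y; rewrite exprS mulrA.
apply: multi_deg_mono; rewrite -[n in (n * E)%N]card_ord -sum_nat_const.
by apply: leq_sum => r _; rewrite -ltnS.
Qed.

Lemma multi_deg_span d Phi : multi_deg d Phi ->
  exists kappa : {ffun 'I_s -> cone_gen_index d} -> k,
    forall (x : 'I_s -> vec k N) (c : 'I_s -> k), (forall i, X (x i)) ->
      Phi (fun i j => c i * x i j) =
      \sum_t kappa t * \prod_i (cone_gen (t i)).@[fun j => c i * x i j].
Proof.
move=> dPhi; apply: (dPhi (fun Phi => exists kappa : {ffun 'I_s -> cone_gen_index d} -> k,
    forall (x : 'I_s -> vec k N) (c : 'I_s -> k), (forall i, X (x i)) ->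
      Phi (fun i j => c i * x i j) =
      \sum_t kappa t * \prod_i (cone_gen (t i)).@[fun j => c i * x i j])).
- split=> [P1 P2 P12 [u hu]||P1 P2 [u hu] [w hw]|c P [u hu]].
  + by exists u => x c Xx; rewrite -P12 hu.
  + by exists (fun=> 0) => x c Xx; rewrite big1 // => t _; rewrite mul0r.
  + exists (fun t => u t + w t) => x c Xx; rewrite hu // hw // -big_split /=.
    by apply: eq_bigr => t _; rewrite mulrDl.
  + exists (fun t => c * u t) => x c' Xx; rewrite hu // mulr_sumr.
    by apply: eq_bigr => t _; rewrite mulrA.
- move=> f sf.
  pose u i := sval (constructive_indefinite_description _ (cone_span (sf i))).
  have uE i : cone_ideal X (f i - \sum_t u i t *: cone_gen t).
    by rewrite /u; case: constructive_indefinite_description.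
  exists (fun t => \prod_i u i (t i)) => x c Xx.
  under [RHS]eq_bigr do rewrite -big_split /=.
  rewrite -(bigA_distr_bigA (fun i t => u i t * (cone_gen t).@[fun j => c i * x i j])) /=.
  apply: eq_bigr => i _; have := uE i (x i) (c i) (Xx i).
  rewrite mevalB => /eqP; rewrite subr_eq0 => /eqP ->.
  by rewrite raddf_sum; apply: eq_bigr => t _; rewrite /= mevalZ.
Qed.

(** Linear algebra: on sums of [s] points, the [E.+1 ^ n] monomials in the forms [l r] with
    exponents at most [E] lie in the span of fewer products of cone generators, so they satisfy a
    linear relation. *)
Lemma vanishing_on_sums n (l : 'I_n -> vec k N) : (2 * s < n)%N ->
  exists2 f : {mpoly k[n]}, f != 0 &
    forall (x : 'I_s -> vec k N) (c : 'I_s -> k), (forall i, X (x i)) ->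
      f.@[fun r => dotv (l r) (fun j => \sum_i c i * x i j)] = 0.
Proof.
move=> lt_sn; pose C := #|{: 'X_{1..N.+1 < n0.+1}}|.
(* With this [E], [C ^ s * (n * E.+1) ^ (2 * s) = E * E.+1 ^ (2 * s)], which is less than [E.+1 ^ n]
   because [2 * s < n]. *)
pose E := (C ^ s * n ^ (2 * s))%N.
pose G (e : {ffun 'I_n -> 'I_E.+1}) (y : 'I_s -> vec k N) :=
  \prod_r dotv (l r) (fun j => \sum_i y i j) ^+ e r.
pose T := {ffun 'I_s -> cone_gen_index (n * E)}.
pose u e : T -> k :=
  sval (constructive_indefinite_description _ (multi_deg_span (multi_deg_prod l e))).
have uE e (x : 'I_s -> vec k N) (c : 'I_s -> k) : (forall i, X (x i)) ->
    G e (fun i j => c i * x i j) =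
    \sum_t u e t * \prod_i (cone_gen (t i)).@[fun j => c i * x i j].
  by rewrite /u; case: constructive_indefinite_description => w /= hw Xx; rewrite -hw.
pose M := \matrix_(i < #|{: {ffun 'I_n -> 'I_E.+1}}|, j < #|{: T}|) u (enum_val i) (enum_val j).
have lt_card : (#|{: T}| < #|{: {ffun 'I_n -> 'I_E.+1}}|)%N.
  rewrite !card_ffun !card_prod !card_ord -/C.
  have n_gt0 : (0 < n)%N by apply: leq_ltn_trans lt_sn.
  have le1 : ((n * E).+1 <= n * E.+1)%N by rewrite mulnS -addn1 addnC leq_add2r.
  have mono m1 m2 e : (m1 <= m2 -> m1 ^ e <= m2 ^ e)%N.
    by case: e => // e le12; rewrite leq_exp2r.
  apply: (@leq_trans (E.+1 ^ (2 * s).+1)); last by rewrite leq_pexp2l.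
  apply: (@leq_ltn_trans (E * E.+1 ^ (2 * s))); last by rewrite expnS ltn_pmul2r ?expn_gt0.
  have EE : E = (C ^ s * n ^ (2 * s))%N by [].
  apply: leq_trans (mono _ (n * E.+1 * (n * E.+1) * C)%N s _) _.
    by rewrite leq_mul2r leq_mul ?orbT.
  rewrite {3}EE [(_ * C)%N]mulnC mulnn !expnMn -!expnD addnn -mul2n mulnA.
  by rewrite leqnn.
have nz_ker : kermx M != 0.
  rewrite -mxrank_eq0 mxrank_ker -lt0n subn_gt0.
  exact: leq_ltn_trans (rank_leq_col _) lt_card.
pose w := nz_row (kermx M).
have nz_w : w != 0 by rewrite nz_row_eq0.
have wM : w *m M = 0 by apply/sub_kermxP; exact: nz_row_sub.
pose mon (e : {ffun 'I_n -> 'I_E.+1}) : 'X_{1..n} := [multinom (e i : nat) | i < n].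
have inj_mon : injective mon.
  move=> e e' /mnmP ee; apply/ffunP => i; apply: val_inj.
  by have := ee i; rewrite !mnmE.
exists (\sum_i w ord0 i *: 'X_[mon (enum_val i)]).
  have [i nz_wi] : exists i, w ord0 i != 0.
    apply: NNPP => no; case/eqP: nz_w; apply/rowP => i; rewrite mxE.
    by apply/eqP; apply: contra_notT no => nz; exists i.
  apply: contraNneq nz_wi => /(congr1 (mcoeff (mon (enum_val i)))).
  rewrite mcoeff0 raddf_sum (bigD1 i) //= mcoeffZ mcoeffX eqxx mulr1 big1.
    by rewrite addr0 => ->.
  move=> i' ne; rewrite mcoeffZ mcoeffX (inj_eq inj_mon) (inj_eq enum_val_inj).
  by rewrite (negPf ne) mulr0.
move=> x c Xx; rewrite raddf_sum /=.
transitivity (\sum_i w ord0 i * G (enum_val i) (fun i j => c i * x i j)).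
  apply: eq_bigr => i _; rewrite mevalZ mevalX; congr (_ * _).
  by apply: eq_bigr => r _; rewrite mnmE.
under eq_bigr do rewrite uE // mulr_sumr.
rewrite exchange_big /= big1 // => t _.
under eq_bigr do rewrite mulrA.
rewrite -mulr_suml (_ : \sum_i _ = 0) ?mul0r //.
move/rowP/(_ (enum_rank t)): wM; rewrite mxE [RHS]mxE => wMt; rewrite -[RHS]wMt.
by apply: eq_bigr => i _; rewrite mxE enum_rankK.
Qed.

End SumOfPoints.
End ConeSpan.

(** * Dimension bounds for sets of bounded rank *)

Lemma zclosure_vanish (k : closedFieldType) N (A : pset k N) (H : {mpoly k[N.+1]}) :
  (forall p, A p -> nonzero p) -> (forall p c, A p -> H.@[fun j => c * p j] = 0) ->
  forall v, zclosure A v -> H.@[v] = 0.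
Proof.
move=> nzA HA v [_ Av].
(* [H] need not be homogeneous, while closed sets are cut out by forms; its components vanish on [A]
   because [H] vanishes on all multiples of points of [A]. *)
pose Z w := nonzero w /\ forall e, (pihomog mdeg e H).@[w] = 0.
have cZ : zclosed Z.
  exists (fun p => exists e, p = pihomog mdeg e H); split=> [_ [e ->]|w].
    by exists e; exact: pihomogP.
  split=> [[nz hw]|[nz hw]]; split=> //; first by move=> _ [e ->].
  by move=> e; apply: hw; exists e.
have [|_ Zv] := Av Z cZ.
  by move=> w Aw; split=> [|e]; [exact: nzA|apply: pihomog_vanish => c; exact: HA].
rewrite (pihomog_partitionE (leqnn (msize H))) raddf_sum big1 // => e _.
exact: Zv.
Qed.

(** As a polynomial in [c] the value has degree exactly [d], with leading coefficient [F.@[o]]. *)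
Lemma root_on_line (k : closedFieldType) n d (F : {mpoly k[n]}) (o v : 'I_n -> k) :
  (0 < d)%N -> F \is d.-homog -> F.@[o] != 0 ->
  exists c, F.@[fun j => v j + c * o j] = 0.
Proof.
move=> d_gt0 hF nz_Fo.
pose h j : {poly k} := (v j)%:P + (o j)%:P * 'X.
have sh j : (size (h j) <= 2)%N.
  apply: leq_trans (size_polyD _ _) _; rewrite geq_max (leq_trans (size_polyC_leq1 _)) //=.
  apply: leq_trans (size_polyMleq _ _) _; rewrite size_polyX addn2 /=.
  by rewrite ltnS size_polyC_leq1.
have sF : (msize F <= d.+1)%N.
  by rewrite msizeE; apply/bigmax_leqP_seq => m mF _; rewrite ltnS (dhomog_mf hF mF).
have [sP tP] := mmap_top idfun sh sF; set P := mmap _ h F in sP tP.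
have {}tP : P`_d = F.@[o].
  rewrite tP (pihomog_dE hF); apply: meval_eq => j.
  by rewrite /h coefD coefC add0r coefCM coefX mulr1.
have [c rc] : exists c, root P c.
  apply/closed_rootP/negP => /eqP sP1; case/eqP: nz_Fo; rewrite -tP.
  by rewrite nth_default // sP1.
exists c; move/rootP: rc => <-.
apply: (mpoly_rmorph_eq (f := meval _)
  (g := horner_eval c \o mmap (polyC \o idfun) h)) => [e|j] /=.
  by rewrite mevalC (mmapC _ (polyC \o idfun)) /horner_eval hornerC.
rewrite mevalXU (mmapX _ (polyC \o idfun)) mmap1U /horner_eval /h.
by rewrite hornerD hornerM !hornerC hornerX [c * _]mulrC.
Qed.

Section DimensionBounds.
Variables (k : closedFieldType) (N : nat) (X : pset k N).
Hypothesis curveX : irreducible_curve X.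

Lemma vanishing_on_rank_le s n (l : 'I_n -> vec k N) : (2 * s < n)%N ->
  exists2 f : {mpoly k[n]}, f != 0 &
    f.@[fun=> 0] = 0 /\
    forall r p c, (r <= s)%N -> rank_le X p r ->
      f.@[fun i => dotv (l i) (fun j => c * p j)] = 0.
Proof.
move=> lt_sn; have [[cX [[x0 Xx0] _]] _] := curveX.
have nX0 : ~ X (fun=> 0) by move=> /(zclosed_nonzero cX) [j]; rewrite eqxx.
(* Only integrality over some pencil is wanted here, so the pencil is taken through the zero vector,
   where vanishing is no condition. *)
have [a [b [_ _ _ noz]]] := pencil_exists curveX nX0.
have [n0 integral] := pencil_integral cX noz.
have [f nz_f hf] := vanishing_on_sums (n0 := n0) integral l lt_sn.
exists f => //; split.
  rewrite -[RHS](hf (fun=> x0) (fun=> 0)) //; apply: meval_eq => i.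
  by rewrite /dotv big1 // => j _; rewrite big1 ?mulr0 // => i' _; rewrite mul0r.
move=> r p c le_rs [x [e [Xx [_ pE]]]].
(* Shorter sums are padded by the point [x0] with coefficient 0. *)
pose x' (i : 'I_s) := if insub (val i) is Some i' then x i' else x0.
pose e' (i : 'I_s) := if insub (val i) is Some i' then c * e i' else 0.
rewrite -[RHS](hf x' e').
  apply: meval_eq => i; apply: eq_bigr => j _; congr (_ * _).
  rewrite pE mulr_sumr [RHS](bigID (fun i : 'I_s => (i < r)%N)) /=.
  rewrite (big_ord_narrow le_rs) /= [X in _ + X]big1 ?addr0.
    by apply: eq_bigr => i' _; rewrite /e' /x' /= valK mulrA.
  by move=> i' /negPf ge; rewrite /e' insubF // mul0r.
by move=> i; rewrite /x'; case: insubP => [u _ _|_].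
Qed.

(** With the [N.+1] coordinates as linear forms, [2 * g <= N] would yield a nonzero polynomial
    vanishing on a dense set. *)
Lemma generic_rank_bound g : generic_rank X g -> (N < 2 * g)%N.
Proof.
move=> [U [[_ nzU] [dU rkU]]]; rewrite ltnNge; apply/negP => le_gN.
pose l (i : 'I_N.+1) : vec k N := fun j => (j == i)%:R.
have lE i v : dotv (l i) v = v i.
  rewrite /dotv (bigD1 i) //= /l eqxx mul1r big1 ?addr0 // => j /negPf->.
  by rewrite mul0r.
have [f nz_f [_ hf]] := vanishing_on_rank_le l (le_gN : (2 * g < N.+1)%N).
have fv v : nonzero v -> f.@[v] = 0.
  move=> nz; apply: (zclosure_vanish nzU _ (dU v nz)) => p c /rkU[rk _].
  by rewrite -[RHS](hf g p c) //; apply: meval_eq => i; rewrite lE.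
have [v] : exists v, (f * 'X_ord0).@[v] != 0.
  by apply: mpoly_nonvanish; rewrite mulf_neq0 // -msize_poly_eq0 msizeX.
rewrite mevalM mevalXU mulf_eq0 negb_or => /andP[/eqP nf nz0].
by apply: nf; apply: fv; exists ord0.
Qed.

(** Projection from a point [o] off the hypersurface maps it onto P^(N-1), since every line through
    [o] meets it. For [2 * s < N] a nonzero polynomial in [N] coordinates would vanish on the
    image. *)
Lemma hypersurface_bound s : hypersurface (secant X s) -> (N <= 2 * s)%N.
Proof.
move=> [F [d [d_gt0 [nz_F [hF secE]]]]]; rewrite leqNgt; apply/negP => lt_sN.
have [o nz_Fo] := mpoly_nonvanish nz_F.
have [i nz_oi] : exists i, o i != 0.
  apply: NNPP => no; case/eqP: nz_Fo.
  transitivity (0 ^+ d * F.@[o]); last by rewrite expr0n eqn0Ngt d_gt0 mul0r.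
  rewrite -(meval_dhomog _ _ hF).
  apply: meval_eq => j; rewrite mul0r; apply/eqP; apply: contra_notT no => nz.
  by exists j.
(* These [N] forms vanish at [o]: they are the coordinates of the projection from [o]. *)
pose l (j : 'I_N) : vec k N :=
  fun t => (t == lift i j)%:R * o i - (t == i)%:R * o (lift i j).
have lE j v : dotv (l j) v = v (lift i j) * o i - v i * o (lift i j).
  rewrite /dotv /l; under eq_bigr do rewrite mulrBl.
  rewrite sumrB (bigD1 (lift i j)) //= eqxx mul1r big1 => [|t /negPf->]; last by rewrite !mul0r.
  rewrite (bigD1 i) //= eqxx mul1r big1 => [|t /negPf->]; last by rewrite !mul0r.
  by rewrite !addr0 ![o _ * _]mulrC.
have [f nz_f [f0 hf]] := vanishing_on_rank_le l lt_sN.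
pose H := f \mPo [tuple linp (l j) | j < N].
have HE v : H.@[v] = f.@[fun j => dotv (l j) v].
  by rewrite comp_mpoly_meval; apply: meval_eq => j; rewrite tnth_mktuple linp_eval.
have Hsec v : secant X s v -> H.@[v] = 0.
  apply: zclosure_vanish => [p []|p c [_ [r]]] //; move=> [le_rs [rk _]].
  by rewrite HE; exact: hf rk.
have [w nz_w] := mpoly_nonvanish nz_f.
pose v0 : vec k N := fun t => if unlift i t is Some j then w j / o i else 0.
have [c Fc] := root_on_line v0 d_gt0 hF nz_Fo.
pose v : vec k N := fun t => v0 t + c * o t.
have lv j : dotv (l j) v = w j.
  rewrite lE /v /v0 liftK unlift_none add0r mulrDl divfK // -addrA.
  by rewrite -!mulrA [o i * _]mulrC subrr addr0.
(* The lift [v] of [w] may be the zero vector, which is no projective point; then [w] is zero and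
   [f0] applies. *)
case/eqP: nz_w; have [nz_v|z_v] := classic (nonzero v).
  rewrite -[RHS](Hsec v) ?HE; first by apply: meval_eq => j; rewrite lv.
  by apply/secE; split=> // p ->.
rewrite -[RHS]f0; apply: meval_eq => j; rewrite -lv lE.
have v_0 t : v t = 0 by apply/eqP; apply: contra_notT z_v => nz; exists t.
by rewrite !v_0 !mul0r subrr.
Qed.

End DimensionBounds.

(** * Fields of fractions *)

Definition asbool (P : Prop) : bool := if excluded_middle_informative P then true else false.

Lemma asboolP (P : Prop) : reflect P (asbool P).
Proof. by rewrite /asbool; case: excluded_middle_informative => h; constructor. Qed.

Section DomainFractions.
Variable Q : comNzRingType.
Hypothesis integralQ : forall x y : Q, x * y = 0 -> (x == 0) || (y == 0).

(* The ignored argument makes the hypothesis available to the instances below. *)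
Definition classical_domain (_ : forall x y : Q, x * y = 0 -> (x == 0) || (y == 0)) : Type := Q.
Local Notation D := (classical_domain integralQ).
HB.instance Definition _ := GRing.ComNzRing.on D.

Definition domain_unit : pred D := fun x => asbool (exists y, y * x = 1).
Definition domain_inv (x : D) : D :=
  if excluded_middle_informative (exists y, y * x = 1) is left h
  then sval (constructive_indefinite_description _ h) else x.

Lemma domain_mulVx : {in domain_unit, left_inverse 1 domain_inv *%R}.
Proof.
move=> x /asboolP hx; rewrite /domain_inv.
case: excluded_middle_informative => // h.
by case: constructive_indefinite_description.
Qed.

Lemma domain_unitP (x y : D) : y * x = 1 -> domain_unit x.
Proof. by move=> yx; apply/asboolP; exists y. Qed.

Lemma domain_inv_out : {in [predC domain_unit], domain_inv =1 id}.
Proof.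
move=> x /asboolP hx; rewrite /domain_inv.
by case: excluded_middle_informative.
Qed.

HB.instance Definition _ :=
  GRing.ComNzRing_hasMulInverse.Build D domain_mulVx domain_unitP domain_inv_out.
HB.instance Definition _ := GRing.ComUnitRing_isIntegral.Build D integralQ.

Lemma domain_embeds : exists (L : fieldType) (f : {rmorphism Q -> L}), injective f.
Proof.
exists {fraction D}, (@FracField.tofrac D : {rmorphism D -> {fraction D}}).
by move=> x y /eqP; rewrite tofrac_eq => /eqP.
Qed.
End DomainFractions.

Section PrimeIdealField.
Local Open Scope quotient_scope.
Variables (R : comNzRingType) (I : R -> Prop).
Hypotheses (idealI : ideal_closed I) (properI : ~ I 1).
Hypothesis primeI : forall f g, I (f * g) -> I f \/ I g.

Definition ideal_pred : R -> bool := fun x => asbool (I x).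

Lemma ideal_pred_idealr : idealr_closed ideal_pred.
Proof.
case: idealI => I0 ID IM; split; first exact/asboolP.
  by apply/negP => /asboolP.
by move=> a u v /asboolP Iu /asboolP Iv; apply/asboolP/ID => //; apply: IM.
Qed.

Lemma ideal_pred_prime : prime_idealr_closed ideal_pred.
Proof. by move=> u v /asboolP/primeI[] h; apply/orP; [left|right]; apply/asboolP. Qed.

HB.instance Definition _ := isIdealr.Build R ideal_pred ideal_pred_idealr.
HB.instance Definition _ := isPrimeIdealrClosed.Build R ideal_pred ideal_pred_prime.

Lemma prime_ideal_field :
  exists (L : fieldType) (ev : {rmorphism R -> L}), forall f, ev f = 0 <-> I f.
Proof.
pose II : prime_idealr R := ideal_pred.
pose Q : comNzRingType := {ideal_quot II}.
have [L [f inj_f]] := domain_embeds (@Quotient.rquot_IdomainAxiom R II : forall x y : Q, _).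
exists L, (f \o (\pi_Q : {rmorphism R -> Q})) => x /=.
have fE : f (\pi_Q x) = 0 <-> \pi_Q x = 0.
  by rewrite -{1}(rmorph0 f); split=> [/inj_f|->].
rewrite fE; have -> : (\pi_Q x = 0) <-> (x - 0 \in II).
  rewrite Quotient.idealrBE; split=> [xE|/eqP]; first by apply/eqP; rewrite xE -(rmorph0 \pi_Q).
  by move=> xE; rewrite -[RHS](rmorph0 \pi_Q).
by rewrite subr0; split=> /asboolP.
Qed.
End PrimeIdealField.

(** * Linear relations at the generic point *)

(** Determinant trick: the vector of the [e t] is an eigenvector with eigenvalue [q], and the
    characteristic polynomial is monic. *)
Lemma root_char_poly_of_stable (K : comNzRingType) (L : fieldType) (phi : {rmorphism K -> L})
    (T : finType) (e : T -> L) (A : T -> T -> K) (q : L) :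
  (exists t, e t != 0) -> (forall t, q * e t = \sum_t' phi (A t t') * e t') ->
  exists2 p : {poly K}, p != 0 & root (map_poly phi p) q.
Proof.
move=> [t0 nz_e] qe.
pose g := \matrix_(i < #|T|, j < #|T|) A (enum_val j) (enum_val i).
pose v := \row_(j < #|T|) e (enum_val j).
exists (char_poly g); first exact/monic_neq0/char_poly_monic.
rewrite map_char_poly -eigenvalue_root_char; apply/eigenvalueP; exists v.
  apply/rowP => j; rewrite !mxE qe (reindex (@enum_val T T)) /=.
    by apply: eq_bigr => i _; rewrite !mxE mulrC.
  by apply: onW_bij; exact: enum_val_bij.
apply: contraNneq nz_e => /rowP/(_ (enum_rank t0)).
by rewrite !mxE enum_rankK => ->.
Qed.

Lemma closed_field_algebraic (k : closedFieldType) (L : fieldType)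
    (phi : {rmorphism k -> L}) (p : {poly k}) (q : L) :
  p != 0 -> root (map_poly phi p) q -> exists c, q = phi c.
Proof.
have [r pE] := closed_field_poly_normal p => nz_p.
rewrite pE map_polyZ rmorph_prod rootZ ?fmorph_eq0 ?lead_coef_eq0 //=.
rewrite (eq_bigr (fun z => 'X - (phi z)%:P)); last by move=> z _; rewrite map_polyXsubC.
have -> : \prod_(z <- r) ('X - (phi z)%:P) = \prod_(z <- map phi r) ('X - z%:P).
  by rewrite big_map.
by rewrite root_prod_XsubC => /mapP[c _ ->]; exists c.
Qed.

Lemma linpX_homog (k : fieldType) N (a : vec k N) n : linp a ^+ n \is n.-homog.
Proof. by have := dhomogMn n (linp_homog a); rewrite mul1n. Qed.

Section AffineIdeal.
Variables (k : closedFieldType) (N : nat) (X : pset k N) (b : vec k N).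
Hypothesis irrX : irreducible_closed X.
Hypothesis bX : exists2 x, X x & dotv b x != 0.

(** The ideal of the affine chart of [X] where [b] does not vanish, realized inside the cone by
    normalizing [b] to 1. *)
Definition affine_ideal (f : {mpoly k[N.+1]}) : Prop :=
  forall x, X x -> dotv b x = 1 -> f.@[x] = 0.

Lemma normalize_point x : X x -> dotv b x != 0 ->
  X (fun j => (dotv b x)^-1 * x j) /\ dotv b (fun j => (dotv b x)^-1 * x j) = 1.
Proof.
move=> Xx nz; split; last by rewrite dotv_scale mulVf.
have [cX _] := irrX; apply: (zclosed_scale cX (c := (dotv b x)^-1)) Xx => //.
by rewrite invr_eq0.
Qed.

Lemma affine_ideal_closed : ideal_closed affine_ideal.
Proof.
split=> [x _ _|f g If Ig x Xx bx|f g Ig x Xx bx]; first exact: meval0.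
  by rewrite mevalD If ?Ig ?addr0.
by rewrite mevalM Ig ?mulr0.
Qed.

Lemma affine_ideal_proper : ~ affine_ideal 1.
Proof.
have [x Xx nz] := bX; have [Xx' bx'] := normalize_point Xx nz.
by move=> /(_ _ Xx' bx') /eqP; rewrite meval1 oner_eq0.
Qed.

Lemma affine_ideal_prime f g : affine_ideal (f * g) -> affine_ideal f \/ affine_ideal g.
Proof.
move=> Ifg.
(* [H f] homogenizes [f] by powers of [linp b]. A further factor [linp b] makes it vanish at the
   points of [X] outside the chart, so that irreducibility of all of [X] applies. *)
pose H (f : {mpoly k[N.+1]}) := \sum_(d < msize f) pihomog mdeg d f * linp b ^+ (msize f - d).
have homH f' : H f' \is (msize f').-homog.
  apply: rpred_sum => d _.
  have := dhomogM (pihomogP mdeg d f') (linpX_homog b (msize f' - d)).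
  by rewrite subnKC // ltnW.
have HE f' x : dotv b x = 1 -> (H f').@[x] = f'.@[x].
  move=> bx; rewrite [in RHS](pihomog_partitionE (leqnn (msize f'))) !raddf_sum.
  by apply: eq_bigr => d _; rewrite /= mevalM rmorphXn /= linp_eval bx expr1n mulr1.
have homB f' : linp b * H f' \is (1 + msize f').-homog.
  exact: dhomogM (linp_homog b) (homH f').
have [_ [_ irr]] := irrX.
have H0 f' x : X x -> dotv b x != 0 ->
    f'.@[fun j => (dotv b x)^-1 * x j] = 0 -> (H f').@[x] = 0.
  move=> Xx nz; have [_ bx'] := normalize_point Xx nz.
  rewrite -(HE f') // (meval_dhomog _ _ (homH f')) => /eqP; rewrite mulf_eq0.
  by rewrite expf_eq0 invr_eq0 (negPf nz) andbF => /eqP.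
have fromH f' : Defs.subsetP X (fun v => nonzero v /\ (linp b * H f').@[v] = 0) ->
    affine_ideal f'.
  move=> sub x Xx bx; have [_] := sub x Xx.
  by rewrite mevalM linp_eval bx mul1r HE.
have [|h|h] := irr _ _ (zclosed_zeros (homB f)) (zclosed_zeros (homB g)).
- move=> x Xx; have nzx := zclosed_nonzero (proj1 irrX) Xx.
  have [bx0|nz] := eqVneq (dotv b x) 0; first by left; rewrite mevalM linp_eval bx0 mul0r.
  have [Xx' bx'] := normalize_point Xx nz.
  have := Ifg _ Xx' bx'; rewrite mevalM => /eqP; rewrite mulf_eq0.
  by move=> /orP[/eqP f0|/eqP g0]; [left|right]; rewrite mevalM (H0 _ x) ?mulr0.
- by left; exact: fromH.
- by right; exact: fromH.
Qed.

Lemma generic_point : exists (L : fieldType) (ev : {rmorphism {mpoly k[N.+1]} -> L}),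
  forall f, ev f = 0 <-> affine_ideal f.
Proof.
exact: prime_ideal_field affine_ideal_closed affine_ideal_proper affine_ideal_prime.
Qed.

End AffineIdeal.

Section GenericPoint.
Variables (k : closedFieldType) (N : nat) (X : pset k N) (a b : vec k N).
Hypothesis curveX : irreducible_curve X.
Hypothesis nondegX : proj_nondegenerate X.
Hypothesis bX : exists2 x, X x & dotv b x != 0.
Hypothesis noz : forall x, X x -> dotv b x = 0 -> dotv a x != 0.
Variables (L : fieldType) (ev : {rmorphism {mpoly k[N.+1]} -> L}).
Hypothesis evE : forall f, ev f = 0 <-> affine_ideal X b f.

Definition constL : k -> L := ev \o @mpolyC N.+1 k.
HB.instance Definition _ := GRing.RMorphism.on constL.

Let alpha := ev (linp a).

Lemma ev_linp c : ev (linp c) = \sum_j constL (c j) * ev 'X_j.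
Proof.
rewrite /linp raddf_sum; apply: eq_bigr => j _ /=.
by rewrite -mul_mpolyC rmorphM.
Qed.

Lemma ev_b : ev (linp b) = 1.
Proof.
apply/eqP; rewrite -subr_eq0 -(rmorph1 ev) -rmorphB; apply/eqP/evE => x Xx bx.
by rewrite mevalB meval1 linp_eval bx subrr.
Qed.

Lemma ev_cone_ideal f : cone_ideal X f -> ev f = 0.
Proof.
move=> If; apply/evE => x Xx _; rewrite -[RHS](If x 1 Xx).
by apply: meval_eq => j; rewrite mul1r.
Qed.

(** These spaces are finite-dimensional over [k] and increase with [n], because [linp b] takes the
    value 1. *)
Definition homog_val n (z : L) : Prop := exists2 f, f \is n.-homog & ev f = z.

Lemma homog_valD n z w : homog_val n z -> homog_val n w -> homog_val n (z + w).
Proof. by move=> [f hf <-] [g hg <-]; exists (f + g); rewrite ?rmorphD ?rpredD. Qed.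

Lemma homog_valN n z : homog_val n z -> homog_val n (- z).
Proof. by move=> [f hf <-]; exists (- f); rewrite ?rmorphN ?rpredN. Qed.

Lemma homog_valM n m z w : homog_val n z -> homog_val m w -> homog_val (n + m) (z * w).
Proof. by move=> [f hf <-] [g hg <-]; exists (f * g); rewrite ?rmorphM ?dhomogM. Qed.

Lemma homog_val_constM n c z : homog_val n z -> homog_val n (constL c * z).
Proof.
move=> [f hf <-]; exists (c *: f); first exact: rpredZ.
by rewrite -mul_mpolyC rmorphM.
Qed.

Lemma homog_val_mono n m z : (n <= m)%N -> homog_val n z -> homog_val m z.
Proof.
move=> /subnKC <- hz; rewrite -[z]mulr1; apply: homog_valM => //.
by exists (linp b ^+ (m - n)); [exact: linpX_homog|rewrite rmorphXn /= ev_b expr1n].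
Qed.

Lemma homog_val_var j : homog_val 1 (ev 'X_j).
Proof. by exists 'X_j => //; exact: dhomogXU. Qed.

Lemma homog_val_alpha n : homog_val n (alpha ^+ n).
Proof.
by exists (linp a ^+ n); [exact: linpX_homog|rewrite rmorphXn].
Qed.

(** The index type contains all monomials of degree at most [n]; those of smaller degree get the
    value 0, so the span consists of values of forms of degree [n] only. *)
Definition homog_gen n (m : 'X_{1..N.+1 < n.+1}) : L :=
  if mdeg m == n then ev 'X_[m] else 0.

Lemma homog_gen_val n m : homog_val n (@homog_gen n m).
Proof.
rewrite /homog_gen; case: eqP => [md|_]; last by exists 0; rewrite ?rmorph0 ?rpred0.
by exists 'X_[m]; rewrite ?dhomogX //=; apply/eqP.
Qed.

Lemma homog_val_gen n z : homog_val n z ->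
  exists c : 'X_{1..N.+1 < n.+1} -> k, z = \sum_m constL (c m) * homog_gen m.
Proof.
move=> [f hf <-]; exists (fun m => f@_m).
have sf : (msize f <= n.+1)%N.
  by rewrite msizeE; apply/bigmax_leqP_seq => m mf _; rewrite ltnS (dhomog_mf hf mf).
rewrite {1}(mpolywE sf) rmorph_sum; apply: eq_bigr => m _ /=.
rewrite -mul_mpolyC rmorphM /homog_gen; case: eqP => // /eqP md.
by rewrite (dhomog_nemf_coeff hf md) /= mpolyC0 rmorph0 mul0r mulr0.
Qed.

Lemma homog_gen_neq0 n : exists m, @homog_gen n m != 0.
Proof.
apply: NNPP => no; have [c /eqP] := homog_val_gen (homog_val_mono (leq0n n) (homog_val_alpha 0)).
rewrite expr0 big1 ?oner_eq0 // => m _; suff -> : homog_gen m = 0 by rewrite mulr0.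
by apply/eqP; apply: contra_notT no => nz; exists m.
Qed.

(** Multiplication by [q] acts on a nonzero finite-dimensional space, so [q] is algebraic over the
    algebraically closed field [k]. *)
Lemma stable_const n q : (forall z, homog_val n z -> homog_val n (q * z)) ->
  exists c, q = constL c.
Proof.
move=> stab.
have H m := homog_val_gen (stab _ (homog_gen_val m)).
pose A m := sval (constructive_indefinite_description _ (H m)).
have AE m : q * homog_gen m = \sum_m' constL (A m m') * homog_gen m'.
  by rewrite /A; case: constructive_indefinite_description.
have [p nz_p] := root_char_poly_of_stable (homog_gen_neq0 n) AE.
exact: closed_field_algebraic.
Qed.

(** The zero sets of [b] and [d] cover [X], and the first one does not contain it. *)
Lemma ev_linp_eq0 d : ev (linp d) = 0 -> forall x, X x -> dotv d x = 0.
Proof.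
move=> /evE Id; have [irrX _] := curveX; have [cX [_ irr]] := irrX.
have [|sub|sub] := irr _ _ (zclosed_zeros (linp_homog b)) (zclosed_zeros (linp_homog d)).
- move=> x Xx; have nzx := zclosed_nonzero cX Xx.
  have [bx0|nz] := eqVneq (dotv b x) 0; [left|right]; split=> //.
    by rewrite linp_eval.
  have [Xx' bx'] := normalize_point irrX Xx nz.
  have /eqP := Id _ Xx' bx'; rewrite !linp_eval dotv_scale mulf_eq0 invr_eq0.
  by rewrite (negPf nz) => /eqP.
- by have [x /sub[_]] := bX; rewrite linp_eval => ->; rewrite eqxx.
- by move=> x /sub[_]; rewrite linp_eval.
Qed.

(** Otherwise [a - c b] vanishes on [X], so [b] has no zero there; all coordinates are then
    constants at the generic point and [X] is a single point, against its chain of length 1. *)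
Lemma alpha_not_const c : alpha <> constL c.
Proof.
move=> alphaE; have [irrX [[Z [irrZ [strictZ Z1X]]] _]] := curveX; have [cX _] := irrX.
have bnz x : X x -> dotv b x != 0.
  move=> Xx; apply/eqP => bx0.
  have : dotv (fun j => a j - c * b j) x = 0.
    apply: ev_linp_eq0 Xx.
    have -> : linp (fun j => a j - c * b j) = linp a - c%:MP * linp b.
      rewrite /linp mulr_sumr -sumrB; apply: eq_bigr => j _.
      by rewrite mul_mpolyC scalerBl scalerA.
    by rewrite rmorphB rmorphM /= ev_b mulr1 -/alpha alphaE subrr.
  rewrite /dotv; under eq_bigr do rewrite mulrBl -mulrA.
  rewrite sumrB -mulr_sumr -/(dotv a x) -/(dotv b x) bx0 mulr0 subr0 => ax0.
  by have := noz Xx bx0; rewrite ax0 eqxx.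
(* Both members of the pencil are now [b], so integrality lowers the degree by factors of value
   1. *)
have nobz x : X x -> dotv b x = 0 -> dotv b x != 0 by move=> Xx _; exact: bnz.
have [n0 hn0] := pencil_integral cX nobz.
have stab j z : homog_val n0 z -> homog_val n0 (ev 'X_j * z).
  move=> hz; have [f hf <-] := homog_valM (homog_val_var j) hz.
  have [g [h [hg hh /ev_cone_ideal/eqP]]] := hn0 n0 f (leqnn _) hf.
  rewrite rmorphB rmorphD !rmorphM /= ev_b !mul1r subr_eq0 => /eqP ->.
  by apply: homog_valD; [exists g|exists h].
have constX j : exists c, ev 'X_j = constL c := stable_const (stab j).
pose v j := sval (constructive_indefinite_description _ (constX j)).
have vE j : ev 'X_j = constL (v j).
  by rewrite /v; case: constructive_indefinite_description.
have XE x : X x -> forall j, x j = dotv b x * v j.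
  move=> Xx j; have nz := bnz x Xx.
  have [Xx' bx'] := normalize_point irrX Xx nz.
  have /evE/(_ _ Xx' bx') : ev ('X_j - (v j)%:MP) = 0 by rewrite rmorphB vE subrr.
  rewrite mevalB mevalC mevalXU => /eqP; rewrite subr_eq0 => /eqP <-.
  by rewrite mulVKf.
have [sub01 nsub10] := strictZ 0%N isT.
have [cZ0 [[y Zy] _]] := irrZ 0%N isT.
apply: nsub10 => w Zw.
have Xw := Z1X w Zw; have Xy := Z1X y (sub01 y Zy).
apply: (zclosed_scale cZ0 (c := dotv b w / dotv b y)) Zy.
  by rewrite mulf_neq0 ?invr_eq0 ?bnz.
by move=> j; rewrite (XE w Xw) [y j](XE y Xy) mulrA divfK ?bnz.
Qed.

Lemma alpha_transcendental (p : {poly k}) : p != 0 -> ~~ root (map_poly constL p) (- alpha).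
Proof.
move=> nz_p; apply/negP => /(closed_field_algebraic nz_p)[c cE].
by apply: (@alpha_not_const (- c)); rewrite rmorphN -cE opprK.
Qed.

Lemma homog_val_integral : exists n0, forall n z, (n0 <= n)%N -> homog_val n.+1 z ->
  exists z1 z2, [/\ homog_val n z1, homog_val n z2 & z = alpha * z1 + z2].
Proof.
have [[cX _] _] := curveX; have [n0 hn0] := pencil_integral cX noz.
exists n0 => n z le_n [f hf <-].
have [g [h [hg hh /ev_cone_ideal/eqP]]] := hn0 n f le_n hf.
rewrite rmorphB rmorphD !rmorphM /= ev_b mul1r subr_eq0 => /eqP ->.
by exists (ev g), (ev h); split=> //; [exists g|exists h].
Qed.

(* Forms of degree n0 + r take values in the span of the products of the powers
   of [alpha] up to r with the values of forms of degree n0. *)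
Lemma homog_val_span n0 :
  (forall n z, (n0 <= n)%N -> homog_val n.+1 z ->
    exists z1 z2, [/\ homog_val n z1, homog_val n z2 & z = alpha * z1 + z2]) ->
  forall r z (P : L -> Prop), homog_val (n0 + r) z ->
    (forall u w, P u -> P w -> P (u + w)) ->
    (forall i w, (i <= r)%N -> homog_val n0 w -> P (alpha ^+ i * w)) -> P z.
Proof.
move=> integral; elim=> [|r IH] z P hz PD Pgen.
  by rewrite -[z]mul1r -(expr0 alpha); apply: Pgen => //; rewrite addn0 in hz.
rewrite addnS in hz; have [z1 [z2 [h1 h2 ->]]] := integral _ _ (leq_addr _ _) hz.
apply: (PD); last by apply: (IH z2 P) => // i w le_i; apply: Pgen; exact: leqW.
apply: (IH z1 (fun w => P (alpha * w))) => // [u w|i w le_i hw].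
  by rewrite mulrDr; exact: PD.
by rewrite mulrA -exprS; apply: Pgen.
Qed.

(* The bounds [low] and [high] make multiplication by a coefficient of [q]
   preserve the values of forms of degree n0 + size q. *)
Lemma quotient_const (q : {poly L}) :
  (forall l, homog_val 1 (q * ('X + alpha%:P))`_l) -> forall l, exists c, q`_l = constL c.
Proof.
move=> hC l; have [n0 integral] := homog_val_integral.
have C0 : homog_val 1 (alpha * q`_0).
  by have := hC 0%N; rewrite mulrDr coefD coefMX add0r coefMC mulrC.
have CS i : homog_val 1 (q`_i + q`_i.+1 * alpha).
  by have := hC i.+1; rewrite mulrDr coefD coefMX coefMC.
have low i : homog_val i.+1 (alpha ^+ i.+1 * q`_i).
  elim: i => [|i IH] //.
  have -> : alpha ^+ i.+2 * q`_i.+1 =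
      alpha ^+ i.+1 * (q`_i + q`_i.+1 * alpha) - alpha ^+ i.+1 * q`_i.
    by rewrite mulrDr addrAC subrr add0r [alpha ^+ i.+2]exprSr -mulrA [alpha * _]mulrC.
  apply: homog_valD; last by apply: homog_valN; exact: homog_val_mono (leqnSn _) IH.
  by rewrite -addn1; apply: homog_valM => //; exact: homog_val_alpha.
pose e := size q.
have high d i : (e - i)%N = d -> homog_val d q`_i.
  elim: d i => [|d IH] i.
    move/eqP; rewrite subn_eq0 => le_e; rewrite nth_default //.
    by exists 0; rewrite ?rmorph0 ?rpred0.
  move=> ei; have e1 : (e - i.+1)%N = d by rewrite subnS ei.
  rewrite -[q`_i](addrK (q`_i.+1 * alpha)); apply: homog_valD.
    by apply: homog_val_mono (CS i).
  by apply: homog_valN; rewrite -addn1; apply: homog_valM (IH _ e1) (homog_val_alpha 1).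
apply: (@stable_const (n0 + e)) => z hz.
apply: (homog_val_span integral (P := fun w => homog_val (n0 + e) (q`_l * w)) hz).
  by move=> u w; rewrite mulrDr; exact: homog_valD.
(* For [i > l] the power of [alpha] absorbs the one in [low], for total degree [n0 + i]; otherwise
   [high] gives [n0 + (e - l) + i]. Neither exceeds [n0 + e]. *)
move=> i w le_i hw; have [lt_li|le_il] := ltnP l i.
  have -> : q`_l * (alpha ^+ i * w) = alpha ^+ l.+1 * q`_l * (alpha ^+ (i - l.+1) * w).
    by rewrite -{1}(subnKC lt_li) exprD -mulrA mulrCA mulrA.
  apply: (homog_val_mono _ (homog_valM (low l) (homog_valM (homog_val_alpha _) hw))).
  by rewrite addnA subnKC // addnC leq_add2l.
apply: (homog_val_mono _ (homog_valM (high _ l erefl) (homog_valM (homog_val_alpha i) hw))).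
by rewrite addnA [(n0 + e)%N]addnC leq_add2r; lia.
Qed.

Lemma relations_multiple_of_pencil (c : 'I_N.+1 -> {poly k}) :
  \sum_j (map_poly constL (c j)).[- alpha] * ev 'X_j = 0 ->
  exists rho : {poly k}, forall j, c j = rho * ((a j)%:P + (b j)%:P * 'X).
Proof.
move=> c0; pose C := \sum_j map_poly constL (c j) * (ev 'X_j)%:P.
have [q Cq] : exists q, C = q * ('X - (- alpha)%:P).
  apply/factor_theorem/eqP; rewrite horner_sum -[RHS]c0; apply: eq_bigr => j _.
  by rewrite hornerM hornerC.
rewrite polyCN opprK in Cq.
have CE l : C`_l = \sum_j constL (c j)`_l * ev 'X_j.
  by rewrite coef_sum; apply: eq_bigr => j _; rewrite coefMC coef_map.
have qconst : forall l, exists r, q`_l = constL r.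
  apply: quotient_const => l; rewrite -Cq CE.
  elim/big_rec: _ => [|j z _ hz]; first by exists 0; rewrite ?rmorph0 ?rpred0.
  by apply: homog_valD hz; apply: homog_val_constM; exact: homog_val_var.
pose rho := \poly_(l < size q) sval (constructive_indefinite_description _ (qconst l)).
have qE : q = map_poly constL rho.
  apply/polyP => l; rewrite coef_map coef_poly; case: ltnP => [_|ge].
    by case: constructive_indefinite_description.
  by rewrite nth_default ?raddf0.
exists rho => j; apply/eqP; rewrite -subr_eq0; apply/eqP/polyP => l; rewrite coef0.
(* For each power of T, the coefficients of [c j - rho * h j] define a linear form vanishing on [X];
   nondegeneracy makes them zero. *)
pose h j := (a j)%:P + (b j)%:P * 'X.
apply: (nondegX (c := fun j => (c j - rho * h j)`_l)) => x Xx.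
apply: (ev_linp_eq0 _ Xx); rewrite ev_linp.
transitivity (C - q * ('X + alpha%:P))`_l; last by rewrite Cq subrr coef0.
have hE : 'X + alpha%:P = \sum_j map_poly constL (h j) * (ev 'X_j)%:P.
  rewrite /h; under eq_bigr do rewrite rmorphD rmorphM /= !map_polyC map_polyX /= mulrDl.
  rewrite big_split /= addrC; congr (_ + _).
    rewrite -[LHS]mul1r -[1]/(1%:P) -ev_b ev_linp rmorph_sum mulr_suml.
    by apply: eq_bigr => i _; rewrite /= polyCM -!mulrA ['X * _]mulrC.
  by rewrite /alpha ev_linp rmorph_sum; apply: eq_bigr => i _; rewrite /= polyCM.
rewrite coefB CE hE qE mulr_sumr coef_sum -sumrB; apply: eq_bigr => i _.
rewrite coefB rmorphB mulrBl; congr (_ - _).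
by rewrite mulrA -rmorphM coefMC coef_map.
Qed.

(** The generic point has [b] equal to 1 and [a] equal to [alpha], so it satisfies a + T b = 0 for T
    = [- alpha]. *)
Definition eval_param : {poly k} -> L := horner_eval (- alpha) \o map_poly constL.
HB.instance Definition _ := GRing.RMorphism.on eval_param.

Lemma eval_paramC c : eval_param c%:P = constL c.
Proof. by rewrite /eval_param /= map_polyC /horner_eval hornerC. Qed.

Lemma eval_paramX : eval_param 'X = - alpha.
Proof. by rewrite /eval_param /= map_polyX /horner_eval hornerX. Qed.

Lemma eval_param_inj p : eval_param p = 0 -> p = 0.
Proof.
move=> p0; apply/eqP; apply: contraT => /alpha_transcendental/negP[].
by apply/rootP; exact: p0.
Qed.

(** Multiplication by a coordinate raises the degree from [n0] to [n0.+1], and integrality brings it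
    back with coefficients linear in T, so the determinant trick applies over [k[T]]. *)
Lemma coordinate_algebraic j :
  exists2 p : {poly {poly k}}, p != 0 & root (map_poly eval_param p) (ev 'X_j).
Proof.
have [n0 integral] := homog_val_integral.
have H m : exists c : 'X_{1..N.+1 < n0.+1} -> {poly k},
    ev 'X_j * @homog_gen n0 m = \sum_m' eval_param (c m') * homog_gen m'.
  have [z1 [z2 [/homog_val_gen[c1 ->] /homog_val_gen[c2 ->] ->]]] :=
    integral _ _ (leqnn _) (homog_valM (homog_val_var j) (homog_gen_val m)).
  exists (fun m => (c2 m)%:P - (c1 m)%:P * 'X).
  rewrite mulr_sumr -big_split; apply: eq_bigr => m' _ /=.
  rewrite rmorphB rmorphM /= !eval_paramC eval_paramX mulrN opprK.
  by rewrite mulrDl addrC -mulrA mulrCA mulrA.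
pose A m := sval (constructive_indefinite_description _ (H m)).
apply: (root_char_poly_of_stable (A := A) (homog_gen_neq0 n0)) => m.
by rewrite /A; case: constructive_indefinite_description.
Qed.

End GenericPoint.

(** * Primitive elements *)

Section FractionSubfield.
Variables (R : idomainType) (L : fieldType) (tau : {rmorphism R -> L}).
Hypothesis tau_inj : forall p, tau p = 0 -> p = 0.

(* The ignored argument makes injectivity available to the instances below. *)
Definition is_fraction (_ : forall p, tau p = 0 -> p = 0) : L -> bool :=
  fun x => asbool (exists p q, q != 0 /\ x = tau p / tau q).
Local Notation F := (is_fraction tau_inj).

Lemma tau_neq0 p : p != 0 -> tau p != 0.
Proof. by apply: contraNneq => /tau_inj->. Qed.

Lemma is_fraction_divring_closed : divring_closed F.
Proof.
split.
- by apply/asboolP; exists 1, 1; rewrite rmorph1 divr1 oner_eq0.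
- move=> _ _ /asboolP[p [q [nz_q ->]]] /asboolP[p' [q' [nz_q' ->]]].
  apply/asboolP; exists (p * q' - p' * q), (q * q'); rewrite mulf_neq0 //; split=> //.
  rewrite rmorphB !rmorphM mulrBl; congr (_ - _).
    by rewrite -mulf_div divff ?mulr1 // tau_neq0.
  by rewrite [tau q * _]mulrC -mulf_div divff ?mulr1 // tau_neq0.
- move=> _ _ /asboolP[p [q [nz_q ->]]] /asboolP[p' [q' [nz_q' ->]]].
  apply/asboolP; have [->|nz_p'] := eqVneq p' 0.
    by exists 0, 1; rewrite !rmorph0 rmorph1 mul0r invr0 mulr0 mul0r oner_eq0.
  exists (p * q'), (q * p'); rewrite mulf_neq0 //; split=> //.
  by rewrite !rmorphM invf_div mulf_div.
Qed.
HB.instance Definition _ := GRing.isDivringClosed.Build L F is_fraction_divring_closed.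

Inductive fraction_field := FractionElt x & x \in F.
Definition fraction_val u := let: FractionElt x _ := u in x.
HB.instance Definition _ := [isSub for fraction_val].
HB.instance Definition _ := [Choice of fraction_field by <:].
HB.instance Definition _ := [SubChoice_isSubComUnitRing of fraction_field by <:].
HB.instance Definition _ := [SubComUnitRing_isSubIntegralDomain of fraction_field by <:].
HB.instance Definition _ := [SubIntegralDomain_isSubField of fraction_field by <:].
Local Notation K := (fraction_field : fieldType).

Lemma fraction_subfield : exists (K : fieldType) (iota : {rmorphism K -> L})
    (kappa : {rmorphism R -> K}),
  (forall p, iota (kappa p) = tau p) /\
  (forall x, exists p q, q != 0 /\ iota x = tau p / tau q).
Proof.
have kP p : tau p \in F.
  by apply/asboolP; exists p, 1; rewrite rmorph1 divr1 oner_eq0.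
pose kappa p : K := FractionElt (kP p).
have kE p : val (kappa p) = tau p by [].
have kB : zmod_morphism kappa by move=> p q; apply: val_inj; rewrite rmorphB /= rmorphB.
have kM : monoid_morphism kappa.
  by split=> [|p q]; apply: val_inj; rewrite ?rmorph1 ?rmorphM /= ?rmorph1 ?rmorphM.
pose k1 := GRing.isZmodMorphism.Build R K kappa kB.
pose k2 := GRing.isMonoidMorphism.Build R K kappa kM.
pose kk : {rmorphism R -> K} := HB.pack kappa k1 k2.
exists K, (val : {rmorphism K -> L}), kk; split=> // x.
by have /asboolP := valP x.
Qed.

End FractionSubfield.

Section PrimitiveElement.
Variables (R : idomainType) (L : fieldType) (tau : {rmorphism R -> L}).
Hypothesis tau_inj : forall p, tau p = 0 -> p = 0.
Hypothesis pcharL : [pchar L] =i pred0.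

Definition algebraic_over (x : L) : Prop :=
  exists2 p : {poly R}, p != 0 & root (map_poly tau p) x.

Lemma clear_denominators (K : fieldType) (iota : {rmorphism K -> L}) :
  (forall x, exists p q, q != 0 /\ iota x = tau p / tau q) ->
  forall q : {poly K}, exists D (Q : {poly R}),
    D != 0 /\ map_poly tau Q = tau D *: map_poly iota q.
Proof.
move=> frac; elim/poly_ind => [|q c [D [Q [nz_D QE]]]].
  by exists 1, 0; rewrite oner_eq0 !rmorph0 scaler0.
have [u [v [nz_v cE]]] := frac c.
exists (D * v), (v *: Q * 'X + (D * u)%:P); rewrite mulf_neq0 //; split=> //.
rewrite !rmorphD !rmorphM /= !map_polyX !map_polyC map_polyZ /= QE cE.
rewrite scalerDr -!scalerAl !scalerA [tau v * _]mulrC -rmorphM; congr (_ + _).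
rewrite -mul_polyC -!polyCM rmorphM /=; congr (_%:P).
by rewrite -mulrA [tau v * _]mulrCA divff ?mulr1 // (tau_neq0 tau_inj).
Qed.

Lemma common_denominator (K : fieldType) (iota : {rmorphism K -> L}) (T : finType)
    (f : T -> K) :
  (forall x, exists p q, q != 0 /\ iota x = tau p / tau q) ->
  exists D (g : T -> R), D != 0 /\ forall t, tau (g t) = tau D * iota (f t).
Proof.
move=> frac; pose v := \row_(i < #|T|) f (enum_val i).
have [D [Q [nz_D QE]]] := clear_denominators frac (rVpoly v).
exists D, (fun t => Q`_(enum_rank t)); split=> // t.
have := congr1 (fun q : {poly L} => q`_(enum_rank t)) QE.
by rewrite coefZ !coef_map coef_rVpoly_ord mxE enum_rankK.
Qed.

(** Independence passes to the fraction field, where a right inverse exists. With denominators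
    cleared the identity lives over [R] and can be specialized. *)
Lemma free_rows_right_inverse n d (A : 'M[R]_(n, d)) :
  (forall c : 'I_n -> R, (forall l, \sum_j c j * A j l = 0) -> forall j, c j = 0) ->
  exists D (B : 'M[R]_(d, n)), D != 0 /\ A *m B = D%:M.
Proof.
move=> freeA; have [K [iota [kappa [kE frac]]]] := fraction_subfield tau_inj.
have kappa_inj p : kappa p = 0 -> p = 0.
  by move=> p0; apply: tau_inj; rewrite -kE p0 rmorph0.
have : row_free (map_mx kappa A).
  rewrite -kermx_eq0; apply/eqP/row_matrixP => i; rewrite row0.
  have : row i (kermx (map_mx kappa A)) *m map_mx kappa A = 0 by rewrite -row_mul mulmx_ker row0.
  move: (row i _) => v vA0.
  have [D [c [nz_D cE]]] := common_denominator (fun j => v ord0 j) frac.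
  have c0 : forall j, c j = 0.
    apply: freeA => l; apply: tau_inj; rewrite rmorph_sum.
    transitivity (tau D * iota ((v *m map_mx kappa A) ord0 l)); last first.
      by rewrite vA0 mxE rmorph0 mulr0.
    rewrite mxE rmorph_sum mulr_sumr; apply: eq_bigr => j _.
    by rewrite !mxE !rmorphM /= cE kE mulrA.
  apply/rowP => j; rewrite mxE; apply/eqP; rewrite -(fmorph_eq0 iota).
  have := cE j; rewrite c0 rmorph0 => /esym/eqP; rewrite mulf_eq0.
  by rewrite (negPf (tau_neq0 tau_inj nz_D)).
move=> /row_freeP[B AB].
have [D [g [nz_D gE]]] := common_denominator (fun t : 'I_d * 'I_n => B t.1 t.2) frac.
exists D, (\matrix_(l, j) g (l, j)); split=> //; apply/matrixP => i j.
apply/eqP; rewrite -subr_eq0; apply/eqP/tau_inj; rewrite rmorphB; apply/eqP; rewrite subr_eq0.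
have /matrixP/(_ i j)/(congr1 (fun x => tau D * iota x)) := AB.
rewrite !mxE rmorph_sum mulr_sumr => ABij; apply/eqP.
transitivity (tau D * iota (i == j)%:R); last first.
  by case: (i == j); rewrite ?rmorph1 ?mulr1 //= !raddf0 mulr0.
rewrite -ABij rmorph_sum; apply: eq_bigr => l _.
by rewrite !mxE !rmorphM /= gE kE mulrCA.
Qed.

Lemma primitive_element n (xi : 'I_n -> L) : (forall i, algebraic_over (xi i)) ->
  exists theta, algebraic_over theta /\
    forall i, exists D (Q : {poly R}), D != 0 /\ tau D * xi i = (map_poly tau Q).[theta].
Proof.
have [K [iota [kappa [kE frac]]]] := fraction_subfield tau_inj.
have tauE : tau =1 iota \o kappa by move=> p; rewrite /= kE.
have algE x : algebraic_over x <-> algebraicOver iota x.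
  split=> [[p nz_p rp]|[p nz_p rp]].
    exists (map_poly kappa p).
      apply: contra nz_p => /eqP p0; apply/eqP/polyP => i; rewrite coef0; apply: tau_inj.
      by rewrite -kE -coef_map p0 coef0 rmorph0.
    by rewrite -map_poly_comp -(eq_map_poly tauE).
  have [D [Q [nz_D QE]]] := clear_denominators frac p.
  exists Q; last by rewrite QE rootZ // (tau_neq0 tau_inj).
  apply: contra nz_p => /eqP Q0; have := QE; rewrite Q0 rmorph0 => /esym/eqP.
  by rewrite scaler_eq0 (negPf (tau_neq0 tau_inj nz_D)) /= map_poly_eq0.
move=> algxi; suff [theta [ath hth]] : exists theta, algebraicOver iota theta /\
    forall i, exists q : {poly K}, (map_poly iota q).[theta] = xi i.
  exists theta; split; first exact/algE.
  move=> i; have [q <-] := hth i; have [D [Q [nz_D QE]]] := clear_denominators frac q.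
  by exists D, Q; rewrite QE hornerZ.
have pcharK : [pchar K] =i pred0 by move=> p; rewrite -(pcharL p) -(fmorph_pchar iota).
have {}algxi i : algebraicOver iota (xi i) by apply/algE.
elim: n xi algxi => [|n IH] xi algxi.
  by exists 0; split; [exact: algebraic0|case].
have [x [ax hx]] := IH (fun i => xi (lift ord0 i)) (fun i => algxi _).
have [p nz_p px] := ax; have [q nz_q qy] := algxi ord0.
have [m /= [[r rx] [s sy]]] := pchar0_PET nz_p px nz_q qy pcharK.
set z := _ - x in rx sy; exists z; split.
  apply: algebraic_sub ax; rewrite -mulr_natr; apply: algebraic_mul; first exact: algxi.
  by rewrite -(rmorph_nat iota); exact: algebraic_id.
move=> i; case: (unliftP ord0 i) => [j ->|->]; last by exists s.
have [u ux] := hx j; exists (u \Po r).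
by rewrite map_comp_poly horner_comp rx.
Qed.

(** A substitute for the minimal polynomial whose coefficients stay in [R], so that it can be
    specialized. *)
Lemma minimal_annihilator theta : algebraic_over theta ->
  exists P : {poly R}, [/\ P != 0, root (map_poly tau P) theta &
    forall P' : {poly R}, P' != 0 -> root (map_poly tau P') theta -> (size P <= size P')%N].
Proof.
move=> [p nz_p rp].
have [s] := ubnP (size p); elim: s p nz_p rp => // s IH p nz_p rp lt_p.
have [[p' [nz_p' rp' lt_p']]|no] := classic (exists p' : {poly R},
    [/\ p' != 0, root (map_poly tau p') theta & (size p' < size p)%N]).
  by apply: (IH p') => //; exact: leq_trans lt_p' _.
exists p; split=> // p' nz_p' rp'; rewrite leqNgt; apply/negP => lt_p'.
by apply: no; exists p'.
Qed.

Section Minimal.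
Variables (theta : L) (P : {poly R}).
Hypotheses (nz_P : P != 0) (rootP : root (map_poly tau P) theta).
Hypothesis minP : forall P' : {poly R},
  P' != 0 -> root (map_poly tau P') theta -> (size P <= size P')%N.

(** Pseudo-division: powers of the leading coefficient are the price of staying over [R]. *)
Lemma minimal_reduce (F : {poly R}) : exists e H G,
  [/\ lead_coef P ^+ e *: F = H * P + G, (size G < size P)%N &
      tau (lead_coef P ^+ e) * (map_poly tau F).[theta] = (map_poly tau G).[theta]].
Proof.
exists (scalp F P), (F %/ P)%R, (F %% P)%R.
have E := Pdiv.Idomain.divp_eq F P; split=> //; first by rewrite Pdiv.Idomain.ltn_modp.
have := congr1 (fun f => (map_poly tau f).[theta]) E.
by rewrite map_polyZ rmorphD rmorphM /= hornerZ hornerD hornerM (eqP rootP) mulr0 add0r.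
Qed.

Lemma minimal_divides (F : {poly R}) : (map_poly tau F).[theta] = 0 ->
  exists e H, lead_coef P ^+ e *: F = H * P.
Proof.
move=> F0; have [e [H [G [E sG GE]]]] := minimal_reduce F.
exists e, H; rewrite E; have [->|nz_G] := eqVneq G 0; first by rewrite addr0.
have := minP nz_G; rewrite /root -GE F0 mulr0 eqxx => /(_ isT).
by rewrite leqNgt sG.
Qed.

(** In characteristic 0 the derivative is nonzero, so its gcd with [P] has smaller degree than [P].
    Then [theta] must be a root of the cofactor [h], which by minimality is as large as [P], leaving
    a constant gcd. *)
Lemma minimal_separable : separable_poly P.
Proof.
have sP : (1 < size P)%N.
  rewrite ltnNge; apply/negP => /size1_polyC PC; move: rootP nz_P.
  rewrite PC map_polyC /= /root hornerC => /eqP/tau_inj->.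
  by rewrite polyC0 eqxx.
have nz_P' : P^`() != 0.
  apply/eqP => /(congr1 (fun f : {poly R} => f`_(size P).-2)).
  rewrite coef_deriv coef0 => /eqP; rewrite -mulr_natr mulf_eq0.
  have -> : (size P).-2.+1 = (size P).-1 by lia.
  rewrite lead_coef_eq0 (negPf nz_P) /= => /eqP/(congr1 tau)/eqP.
  rewrite rmorph_nat rmorph0 (proj1 (pcharf0P L) pcharL).
  by case: (size P) sP => [|[]].
have sP' : (size P^`() < size P)%N by exact: lt_size_deriv.
rewrite unlock /separable_poly /coprimep.
have /Pdiv.Idomain.dvdpP[[c h] /= nz_c E] : gcdp P P^`() %| P by exact: Pdiv.Idomain.dvdp_gcdl.
have sg : (size (gcdp P P^`()) < size P)%N.
  by apply: leq_ltn_trans sP'; apply: Pdiv.Idomain.dvdp_leq => //; exact: Pdiv.Idomain.dvdp_gcdr.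
have nz_cP : c *: P != 0 by rewrite -mul_polyC mulf_neq0 // polyC_eq0.
have := nz_cP; rewrite E mulf_eq0 negb_or => /andP[nz_h nz_g].
have : root (map_poly tau (h * gcdp P P^`())) theta.
  by rewrite -E map_polyZ /root hornerZ (eqP rootP) mulr0.
rewrite rmorphM rootM => /orP[/(minP nz_h)|/(minP nz_g)]; last by rewrite leqNgt sg.
have := congr1 (fun f : {poly R} => size f) E; rewrite size_scale // size_mul //.
have := nz_g; rewrite -size_poly_gt0 => g_gt0 -> le_h; apply/eqP.
move: g_gt0 le_h; set x := size (gcdp _ _); set y := size h; lia.
Qed.

End Minimal.
Lemma primitive_presentation n (xi : 'I_n -> L) : (forall i, algebraic_over (xi i)) ->
  exists theta (P : {poly R}) D (Q : 'I_n -> {poly R}),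
  [/\ P != 0, root (map_poly tau P) theta,
      forall P' : {poly R}, P' != 0 -> root (map_poly tau P') theta -> (size P <= size P')%N,
      D != 0 &
      forall i, (size (Q i) < size P)%N /\ tau D * xi i = (map_poly tau (Q i)).[theta]].
Proof.
move=> /primitive_element[theta [/minimal_annihilator[P [nz_P rootP minP]] xiE]].
have redE i : exists DG : R * {poly R}, [/\ DG.1 != 0, (size DG.2 < size P)%N &
    tau DG.1 * xi i = (map_poly tau DG.2).[theta]].
  have [D [Q [nz_D QE]]] := xiE i.
  have [e [H [G [_ sG GE]]]] := minimal_reduce nz_P rootP Q.
  exists (lead_coef P ^+ e * D, G); split=> //=.
    by rewrite mulf_neq0 // expf_neq0 // lead_coef_eq0.
  by rewrite rmorphM -mulrA QE GE.
pose DG i := sval (constructive_indefinite_description _ (redE i)).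
have DGE i : [/\ (DG i).1 != 0, (size (DG i).2 < size P)%N &
    tau (DG i).1 * xi i = (map_poly tau (DG i).2).[theta]].
  by rewrite /DG; case: constructive_indefinite_description.
exists theta, P, (\prod_i (DG i).1), (fun i => (\prod_(j | j != i) (DG j).1) *: (DG i).2).
split=> //; first by apply/prodf_neq0 => i _; case: (DGE i).
move=> i; have [_ sG GE] := DGE i; split.
  exact: leq_ltn_trans (size_scale_leq _ _) sG.
by rewrite map_polyZ hornerZ -GE (bigD1 i) //= rmorphM mulrA [tau _ * tau _]mulrC.
Qed.

End PrimitiveElement.

(** * Special fibres *)

(** On the hyperplane [h] the coordinate [i0] is determined by the others, so an invertible minor of
    size [N] suffices; its invertibility also keeps the chosen points projectively distinct. *)
Lemma spanning_points_rank_le (k : closedFieldType) N (X : pset k N) (p h : vec k N) d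
    (y : 'I_d -> vec k N) i0 :
  (forall i, X (y i)) -> h i0 != 0 -> dotv h p = 0 -> (forall i, dotv h (y i) = 0) ->
  row_free (\matrix_(j < N, i < d) y i (lift i0 j)) -> rank_le X p N.
Proof.
move=> Xy nz_h hp hy; set Y := \matrix_(j, i) _ => freeY.
have fullY : row_full Y^T by rewrite -/(row_full _) /row_full mxrank_tr; exact: freeY.
pose f := fullrankfun fullY; pose Z := rowsub f Y^T.
have unitZ : Z \in unitmx := fullrowsub_unit fullY.
pose c := (\row_j p (lift i0 j)) *m invmx Z.
have cZ : c *m Z = \row_j p (lift i0 j) by rewrite mulmxKV.
have coordE (z : vec k N) : dotv h z = h i0 * z i0 + \sum_j h (lift i0 j) * z (lift i0 j).
  by rewrite /dotv (bigD1_ord i0).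
have pE j : p (lift i0 j) = \sum_(i < N) c ord0 i * y (f i) (lift i0 j).
  have /rowP/(_ j) := cZ; rewrite !mxE => <-.
  by apply: eq_bigr => i _; rewrite !mxE.
exists (fun i => y (f i)), (fun i => c ord0 i); split=> [i|]; first exact: Xy.
split=> [i j ne_ij [e [nz_e yE]]|l].
  have : (delta_mx 0 i - e *: delta_mx 0 j : 'rV_N) *m Z = 0.
    rewrite mulmxBl -scalemxAl -!rowE; apply/rowP => l; rewrite !mxE.
    by rewrite yE subrr.
  move/(congr1 (mulmx^~ (invmx Z))); rewrite mulmxK // mul0mx => /rowP/(_ i).
  rewrite !mxE !eqxx (negPf ne_ij) mulr0 subr0 => /eqP.
  by rewrite oner_eq0.
case: (unliftP i0 l) => [j ->|->]; first exact: pE.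
apply: (mulfI nz_h); apply: (addIr (\sum_j h (lift i0 j) * p (lift i0 j))).
rewrite -coordE hp; under [X in _ + X]eq_bigr do rewrite pE mulr_sumr.
rewrite [X in _ + X]exchange_big mulr_sumr -big_split /=; apply/esym/big1 => i _.
transitivity (c ord0 i * dotv h (y (f i))); last by rewrite hy mulr0.
rewrite coordE mulrDr mulr_sumr mulrCA; congr (_ + _).
by apply: eq_bigr => j _; rewrite mulrCA.
Qed.

Lemma separable_roots (k : closedFieldType) (p : {poly k}) d : size p = d.+1 ->
  separable_poly p -> exists r : 'I_d -> k, injective r /\ forall i, root p (r i).
Proof.
move=> sp sepp; have [rs pE] := closed_field_poly_normal p.
have nz_p : p != 0 by rewrite -size_poly_eq0 sp.
have srs : size rs = d.
  by move: sp; rewrite pE size_scale ?lead_coef_eq0 // size_prod_XsubC => -[].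
have uniq_rs : uniq rs.
  rewrite -separable_prod_XsubC.
  by rewrite pE (eqp_separable (eqp_scale _ _)) ?lead_coef_eq0 in sepp.
exists (fun i => rs`_i); split=> [i j /eqP|i].
  by rewrite nth_uniq ?srs // => /eqP/val_inj.
by rewrite pE rootZ ?lead_coef_eq0 // root_prod_XsubC mem_nth // srs.
Qed.

Lemma Vandermonde_unit (k : fieldType) d (r : 'I_d -> k) : injective r ->
  (\matrix_(l < d, i < d) r i ^+ l) \in unitmx.
Proof.
move=> inj_r; pose a := \row_i r i.
have -> : \matrix_(l < d, i < d) r i ^+ l = Vandermonde d a.
  by apply/matrixP => l i; rewrite !mxE.
rewrite unitmxE unitfE det_Vandermonde; apply/prodf_neq0 => i _.
apply/prodf_neq0 => j lt_ij; rewrite !mxE subr_eq0 (inj_eq inj_r).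
by apply: contraTneq lt_ij => ->; rewrite ltnn.
Qed.

Section SpecialFibre.
Variables (k : closedFieldType) (N : nat) (X : pset k N) (a b : vec k N).
Hypothesis pchark : [pchar k] =i pred0.
Hypothesis curveX : irreducible_curve X.
Hypothesis nondegX : proj_nondegenerate X.
Hypothesis bX : exists2 x, X x & dotv b x != 0.
Hypothesis noz : forall x, X x -> dotv b x = 0 -> dotv a x != 0.
Variables (L : fieldType) (ev : {rmorphism {mpoly k[N.+1]} -> L}).
Hypothesis evE : forall f, ev f = 0 <-> affine_ideal X b f.

Local Notation tau := (eval_param a ev).
Local Notation xi j := (ev 'X_j).

Variables (theta : L) (P : {poly {poly k}}) (D : {poly k}) (Q : 'I_N.+1 -> {poly {poly k}}).
Hypotheses (nz_P : P != 0) (rootP : root (map_poly tau P) theta).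
Hypothesis minP : forall P' : {poly {poly k}},
  P' != 0 -> root (map_poly tau P') theta -> (size P <= size P')%N.
Hypothesis nz_D : D != 0.
Hypothesis QE : forall j, (size (Q j) < size P)%N /\ tau D * xi j = (map_poly tau (Q j)).[theta].

Let tau_inj : forall p, tau p = 0 -> p = 0 := eval_param_inj curveX bX noz evE.

Let pcharL : [pchar L] =i pred0.
Proof. by move=> p; rewrite (fmorph_pchar (constL ev)) pchark. Qed.

Section Point.
Variables (s r : k).
Hypotheses (Ds : D.[s] != 0) (lcs : (lead_coef P).[s] != 0).
Hypothesis rootr : root (map_poly (horner_eval s) P) r.

(** Since [Q j] represents [D * xi j], this specializes the generic point up to the factor [D.[s]],
    which homogeneous equations ignore. *)
Definition special_point : vec k N := fun j => (map_poly (horner_eval s) (Q j)).[r].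

(** Up to a power of the leading coefficient, a relation at [theta] is a multiple of [P], and this
    survives at [s] and [r]. *)
Lemma specialize_relation (F : {poly {poly k}}) :
  (map_poly tau F).[theta] = 0 -> (map_poly (horner_eval s) F).[r] = 0.
Proof.
move=> /(minimal_divides nz_P rootP minP)[e [H E]].
have := congr1 (fun f => (map_poly (horner_eval s) f).[r]) E.
rewrite map_polyZ rmorphM /= hornerZ hornerM (eqP rootr) mulr0 => /eqP.
rewrite mulf_eq0 => /orP[|/eqP //].
by rewrite /horner_eval horner_exp expf_eq0 (negPf lcs) andbF.
Qed.

Definition lift_mpoly : {mpoly k[N.+1]} -> {poly {poly k}} :=
  mmap (polyC \o (@polyC k)) Q.
HB.instance Definition _ := GRing.RMorphism.on lift_mpoly.

Lemma lift_mpolyC c : lift_mpoly c%:MP = c%:P%:P.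
Proof. exact: (mmapC _ (polyC \o (@polyC k))). Qed.

Lemma lift_mpolyX j : lift_mpoly 'X_j = Q j.
Proof. by rewrite /lift_mpoly (mmapX _ (polyC \o (@polyC k))) mmap1U. Qed.

Lemma lift_mpoly_theta p :
  (map_poly tau (lift_mpoly p)).[theta] = mmap (constL ev) (fun j => tau D * xi j) p.
Proof.
apply: (mpoly_rmorph_eq (f := horner_eval theta \o map_poly tau \o lift_mpoly)
  (g := mmap (constL ev) _)) => [c|j] /=.
  by rewrite lift_mpolyC map_polyC /horner_eval hornerC /= eval_paramC mmapC.
by rewrite lift_mpolyX mmapX mmap1U; have [_ ->] := QE j.
Qed.

Lemma lift_mpoly_special p :
  (map_poly (horner_eval s) (lift_mpoly p)).[r] = p.@[special_point].
Proof.
apply: (mpoly_rmorph_eq (f := horner_eval r \o map_poly (horner_eval s) \o lift_mpoly)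
  (g := meval _)) => [c|j] /=.
  by rewrite lift_mpolyC map_polyC /horner_eval hornerC /= /horner_eval hornerC mevalC.
by rewrite lift_mpolyX mevalXU.
Qed.

Lemma mmap_ev p : mmap (constL ev) (fun j => xi j) p = ev p.
Proof.
apply: (mpoly_rmorph_eq (f := mmap (constL ev) _) (g := ev)) => [c|j] /=.
  by rewrite mmapC.
by rewrite mmapX mmap1U.
Qed.

Lemma special_point_linear (c : 'I_N.+1 -> {poly k}) (e : {poly k}) :
  \sum_j tau (c j) * xi j = tau e ->
  \sum_j (c j).[s] * special_point j = D.[s] * e.[s].
Proof.
move=> cE; pose F := \sum_j (c j)%:P * Q j - (D * e)%:P.
have : (map_poly tau F).[theta] = 0.
  rewrite rmorphB rmorph_sum hornerD hornerN horner_sum /= map_polyC hornerC /=.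
  rewrite rmorphM /= -cE mulr_sumr -sumrB big1 // => j _.
  rewrite rmorphM /= map_polyC hornerM hornerC; have [_ <-] := QE j.
  by rewrite mulrCA subrr.
move/specialize_relation; rewrite rmorphB rmorph_sum hornerD hornerN horner_sum /=.
rewrite map_polyC hornerC /= -[horner_eval s _]/((D * e).[s]) hornerM => /eqP.
rewrite subr_eq0 => /eqP <-.
by apply: eq_bigr => j _; rewrite rmorphM /= map_polyC hornerM hornerC.
Qed.

Lemma special_point_curve : X special_point.
Proof.
have [[[S [homS XE]] _] _] := curveX; apply/XE; split.
  apply: NNPP => no.
  have y0 j : special_point j = 0.
    by apply/eqP; apply: contra_notT no => nz; exists j.
  (* The form [b] takes the value [D.[s]] at the special point, which therefore is not zero. *)
  have := @special_point_linear (fun j => (b j)%:P) 1.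
  rewrite rmorph1 hornerC mulr1 => H; case/eqP: Ds; rewrite -H.
    by rewrite big1 // => j _; rewrite y0 mulr0.
  rewrite -(ev_b evE) ev_linp; apply: eq_bigr => j _.
  by rewrite eval_paramC.
move=> p Sp; have [d hp] := homS p Sp.
rewrite -lift_mpoly_special; apply: specialize_relation.
rewrite lift_mpoly_theta (mmap_dhomog _ _ _ hp) mmap_ev.
suff -> : ev p = 0 by rewrite mulr0.
by apply/evE => x /XE[_ Sx] _; exact: Sx.
Qed.

Lemma special_point_hyperplane : dotv (fun j => a j + s * b j) special_point = 0.
Proof.
transitivity (D.[s] * (0 : {poly k}).[s]); last by rewrite horner0 mulr0.
rewrite -(@special_point_linear (fun j => (a j)%:P + 'X * (b j)%:P)).
  by apply: eq_bigr => j _; rewrite hornerD hornerM !hornerC hornerX.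
rewrite rmorph0 -[RHS](subrr (ev (linp a))) -[X in _ - X]mulr1 -(ev_b evE).
rewrite -mulNr !ev_linp mulr_sumr -big_split; apply: eq_bigr => j _ /=.
by rewrite rmorphD rmorphM /= !eval_paramC eval_paramX ev_linp mulrDl mulrA.
Qed.

End Point.

(** A relation among the coordinates other than [i0] is a multiple of a + T b, whose coefficient at
    [i0] is nonzero; hence the multiplier is 0. *)
Lemma free_coefficient_rows i0 d (c : 'I_N -> {poly k}) : b i0 != 0 -> size P = d.+1 ->
  (forall l : 'I_d, \sum_j c j * (Q (lift i0 j))`_l = 0) -> forall j, c j = 0.
Proof.
move=> nz_b sP c0.
have Qc0 : \sum_j (c j)%:P * Q (lift i0 j) = 0.
  apply/polyP => l; rewrite coef_sum coef0; have [lt_ld|le_dl] := ltnP l d.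
    by rewrite -[RHS](c0 (Ordinal lt_ld)); apply: eq_bigr => j _; rewrite coefCM.
  apply: big1 => j _; rewrite coefCM nth_default ?mulr0 //.
  by have [sQ _] := QE (lift i0 j); move: sQ; rewrite sP ltnS => /leq_trans; apply.
pose c' j := if unlift i0 j is Some j' then c j' else 0.
have [rho rhoE] : exists rho : {poly k}, forall j, c' j = rho * ((a j)%:P + (b j)%:P * 'X).
  apply: (relations_multiple_of_pencil curveX nondegX bX noz evE).
  apply: (mulfI (tau_neq0 tau_inj nz_D)); rewrite mulr0.
  have := congr1 (fun f => (map_poly tau f).[theta]) Qc0.
  rewrite rmorph0 horner0 rmorph_sum horner_sum => Qc.
  rewrite (bigD1_ord i0) //= {1}/c' unlift_none rmorph0 horner0 mul0r add0r mulr_sumr -[RHS]Qc.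
  apply: eq_bigr => j _; rewrite rmorphM /= map_polyC hornerM hornerC /c' liftK.
  by have [_ <-] := QE (lift i0 j); rewrite mulrCA.
have nz_f : (a i0)%:P + (b i0)%:P * 'X != 0.
  apply: contraNneq nz_b => /(congr1 (fun f : {poly k} => f`_1)).
  by rewrite coefD coefC coefCM coefX coef0 add0r mulr1 => ->.
have rho0 : rho = 0.
  have := rhoE i0; rewrite /c' unlift_none => /esym/eqP.
  by rewrite mulf_eq0 (negPf nz_f) orbF => /eqP.
by move=> j; have := rhoE (lift i0 j); rewrite /c' liftK rho0 mul0r.
Qed.

Lemma rank_le_of_presentation p : dotv a p = 0 -> dotv b p = 0 -> rank_le X p N.
Proof.
move=> ap bp; pose d := (size P).-1.
have sP : size P = d.+1 by rewrite prednK // size_poly_gt0.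
have [i0 nz_b] : exists i0, b i0 != 0.
  have [x _ nz] := bX; apply: NNPP => no; case/eqP: nz; apply: big1 => j _.
  suff -> : b j = 0 by rewrite mul0r.
  by apply/eqP; apply: contra_notT no => nz; exists j.
pose A := \matrix_(j < N, l < d) (Q (lift i0 j))`_l.
have [E [B [nz_E AB]]] : exists E (B : 'M_(d, N)), E != 0 /\ A *m B = E%:M.
  apply: (free_rows_right_inverse tau_inj) => c c0; apply: (free_coefficient_rows nz_b sP).
  by move=> l; rewrite -[RHS](c0 l); apply: eq_bigr => j _; rewrite mxE.
have [u [v [delta [nz_delta uvE]]]] : exists u v delta,
    delta != 0 /\ u * P + v * P^`() = delta%:P.
  have := minimal_separable tau_inj pcharL nz_P rootP minP; rewrite unlock /separable_poly.
  move=> /Pdiv.Idomain.Bezout_coprimepP[[u v] /= /Pdiv.Idomain.eqp_size].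
  rewrite size_poly1 => /eqP/size_poly1P[delta nz_delta uvE].
  by exists u, v, delta.
pose hyp := (a i0)%:P + (b i0)%:P * 'X.
have nz_hyp : hyp != 0.
  apply: contraNneq nz_b => /(congr1 (fun f : {poly k} => f`_1)).
  by rewrite coefD coefC coefCM coefX coef0 add0r mulr1 => ->.
(* At [s], [D] keeps the special points nonzero, [E] the right inverse, [delta] separability,
   [lead_coef P] the degree, and [hyp] the coefficient of the hyperplane at [i0]. *)
have [s] : exists s, ~~ root (D * E * delta * lead_coef P * hyp) s.
  by apply/closed_nonrootP; rewrite !mulf_neq0 ?lead_coef_eq0.
rewrite !rootM !negb_or /root => /andP[/andP[/andP[/andP[Ds Es] deltas] lcs] hyps].
pose Ps := map_poly (horner_eval s) P.
have sPs : size Ps = d.+1 by rewrite -sP size_map_poly_id0.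
have sepPs : separable_poly Ps.
  rewrite unlock /separable_poly; apply/Pdiv.Idomain.Bezout_coprimepP.
  exists (map_poly (horner_eval s) u, map_poly (horner_eval s) v) => /=.
  rewrite /Ps deriv_map -!rmorphM -rmorphD uvE /= map_polyC /=.
  by rewrite -size_poly_eq1 size_polyC deltas.
have [r [inj_r rootr]] := separable_roots sPs sepPs.
apply: (@spanning_points_rank_le _ _ _ _ (fun j => a j + s * b j) d
  (fun i => special_point s (r i)) i0).
- by move=> i; exact: special_point_curve.
- by move: hyps; rewrite hornerD hornerM !hornerC hornerX mulrC.
- rewrite /dotv; under eq_bigr do rewrite mulrDl -mulrA.
  by rewrite big_split /= -mulr_sumr -/(dotv a p) -/(dotv b p) ap bp mulr0 addr0.
- by move=> i; exact: special_point_hyperplane.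
(* The coordinates are polynomials of degree below [d] evaluated at [d] distinct roots: the
   coefficient matrix at [s] times an invertible Vandermonde matrix. *)
pose V := \matrix_(l < d, i < d) r i ^+ l; have unitV := Vandermonde_unit inj_r.
have -> : \matrix_(j < N, i < d) special_point s (r i) (lift i0 j) =
    map_mx (horner_eval s) A *m V.
  apply/matrixP => j i; rewrite !mxE /special_point.
  rewrite (@horner_coef_wide _ d).
    by apply: eq_bigr => l _; rewrite !mxE coef_map.
  have [sQ _] := QE (lift i0 j); rewrite sP ltnS in sQ.
  by apply/leq_sizeP => l le_l; rewrite coef_map nth_default ?raddf0 //; exact: leq_trans le_l.
apply/row_freeP; exists (invmx V *m map_mx (horner_eval s) B *m (E.[s]^-1)%:M).
rewrite !mulmxA mulmxK // -map_mxM AB map_scalar_mx -scalar_mxM.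
by rewrite /horner_eval /= mulfV.
Qed.

End SpecialFibre.

(** * The bound of the maximal rank by N, and the theorem *)

Lemma rank_le_dimension (k : closedFieldType) N (X : pset k N) (p : vec k N) :
  [pchar k] =i pred0 -> irreducible_curve X -> proj_nondegenerate X ->
  ~ X p -> rank_le X p N.
Proof.
move=> pchark curveX nondegX nXp.
have [a [b [ap bp bX noz]]] := pencil_exists curveX nXp.
have [L [ev evE]] := generic_point (proj1 curveX) bX.
have tau_inj := eval_param_inj curveX bX noz evE.
have pcharL : [pchar L] =i pred0 by move=> q; rewrite (fmorph_pchar (constL ev)) pchark.
have [theta [P [D [Q [nz_P rootP minP nz_D QE]]]]] :=
  primitive_presentation tau_inj pcharL (coordinate_algebraic curveX noz evE).
exact: (rank_le_of_presentation pchark curveX nondegX bX noz evE nz_P rootP minP nz_D QE ap bp).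
Qed.

(** All nonzero vectors of P^0 are proportional, which excludes a strict inclusion of nonempty
    closed sets. *)
Lemma irreducible_curve_dim (k : closedFieldType) N (X : pset k N) :
  irreducible_curve X -> (0 < N)%N.
Proof.
move=> [_ [[Z [irrZ [strictZ _]]] _]]; rewrite lt0n; apply/eqP => N0; subst N.
have [sub01 nsub10] := strictZ 0%N isT; apply: nsub10 => w Zw.
have [cZ0 [[y Zy] _]] := irrZ 0%N isT; have [cZ1 _] := irrZ 1%N isT.
have [i nz_w] := zclosed_nonzero cZ1 Zw; have [j nz_y] := zclosed_nonzero cZ0 Zy.
rewrite !ord1 in nz_w nz_y.
apply: (zclosed_scale cZ0 (c := w ord0 / y ord0)) Zy; first by rewrite mulf_neq0 ?invr_eq0.
by move=> l; rewrite ord1 divfK.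
Qed.

Theorem theorem3p7 (k : closedFieldType) (N : nat) (X : pset k N) (g m : nat) :
  ([pchar k]%R =i pred0) ->
  irreducible_curve X -> proj_nondegenerate X ->
  generic_rank X g -> max_rank X m ->
  (m <= 2 * g - 1)%N /\ (hypersurface (secant X (g - 1)) -> (m <= 2 * g - 2)%N).
Proof.
move=> pchark curveX nondegX rkg [[p [nz_p [_ minm]]] _].
have N_gt0 := irreducible_curve_dim curveX.
have le_mN : (m <= N)%N.
  rewrite leqNgt; apply/negP => lt_Nm.
  have [Xp|nXp] := classic (X p); last first.
    by apply: (minm N) => //; exact: rank_le_dimension.
  (* A point of [X] has rank at most 1, which is less than [m] because [0 < N < m]. *)
  apply: (minm 1%N); first exact: leq_ltn_trans lt_Nm.
  exists (fun=> p), (fun=> 1); split=> //; split=> [i j|l].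
    by rewrite !ord1 eqxx.
  by rewrite big_ord1 mul1r.
split; first by have := generic_rank_bound curveX rkg; lia.
by move=> /(hypersurface_bound curveX); lia.
Qed.
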